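(* Let $k\in\mathbb{N}\cup\{0\}$ and $\alpha_{-1},\alpha_0,\dots,\alpha_{k-1},\varepsilon_0,\dots,\varepsilon_k\in\mathbb{R}_+$, and put $\varepsilon=\min\{\frac{(k+2)\varepsilon_i}{k+1-i}\mid i\in\{0,\dots,k\}\}$. Suppose there are $h_{-1},\dots,h_{k-1}\in(0,1]$ with \[ U(k+2)\sum_{i=0}^{k}\binom{k+2}{i+2}(i+1)\frac{\alpha_{i-1}+h_{i-1}}{h_i h_{i+1}\cdots h_{k-1}}<\varepsilon. \tag{$*$} \] Let $\gamma=h_{-1}h_0\cdots h_{k-1}$ and let $\beta$ be $\varepsilon$ minus the left-hand side of $( * )$. Then for every sheaved $d$-complex $(X,\mathcal{F})$ with $d\ge k+1$ such that (1) $(X,\mathcal{F})$ is an $i$-local $\varepsilon_i$-coboundary expander in dimension $k$ for all $i\in\{0,\dots,k\}$, (2) $X$ is an $i$-local $\alpha_i$-skeleton expander for all $i\in\{-1,\dots,k-1\}$, and (3) $\mathcal{F}(x)\ne0$ for all $x\in X(k+1)$, the pair $(X,\mathcal{F})$ $\beta$-expands $\gamma$-small locally minimal $k$-cochains.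
   Context: $U(n)$: a collection $E$ of subsets of $\{1,\dots,n\}$ is an $n$-vine if $\{1,\dots,n\}\in E$ and every $s\in E$ admits a chain $s=s_i\subseteq s_{i+1}\subseteq\dots\subseteq s_n=\{1,\dots,n\}$ with $s_j\in E$ and $|s_j|=j$; $s\in E$ is terminal if no maximal proper subset of $s$ (i.e. of size $|s|-1$) lies in $E$; $U(n)$ is the maximum number of terminal sets over all $n$-vines. A $d$-complex is a finite simplicial complex (faces include $\emptyset$) in which every face lies in a $d$-face; $X(i)$ = $i$-faces; link $X_z=\{x\setminus z:z\subseteq x\in X\}$. Canonical weight of $x\in X(k)$: $w(x)=\binom{d+1}{k+1}^{-1}|X(d)|^{-1}|\{y\in X(d):y\supseteq x\}|$. $X$ is an $\alpha$-skeleton expander if $w(E(S))\le w(S)^2+\alpha w(S)$ for all $S\subseteq X(0)$, where $E(S)$ is the set of edges both of whose $0$-faces lie in $S$; it is an $i$-local $\alpha$-skeleton expander if every link $X_z$, $z\in X(i)$, is an $\alpha$-skeleton expander with respect to its own canonical weights (for $i=-1$ this means $X$ itself). Sheaf $\mathcal{F}$: abelian groups on nonempty faces, restriction maps $\mathrm{res}_{y\leftarrow x}$ compatible under composition; augmented sheaves also include $\emptyset$; $\mathcal{F}_z$ on $X_z$ given by $\mathcal{F}_z(x)=\mathcal{F}(x\cup z)$. Cochains $C^k$ (alternating families over ordered $k$-faces), $d_k f(v_0..v_{k+1})=\sum_i(-1)^i\mathrm{res}\, f(\dots\widehat{v_i}\dots)$, $B^k=\mathrm{im}\,d_{k-1}$.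 Norm $\|f\|=w(\mathrm{supp} f)$ (canonical weights of the complex at hand); mass $m(k)=w(\{x\in X(k):\mathcal{F}(x)\ne0\})$. $\varepsilon$-coboundary expander in dimension $k$: $\|d_kf\|m(k)\ge\varepsilon\min_{b\in B^k}\|f+b\|m(k+1)$ for all $f$; $i$-local version: $(X_z,\mathcal{F}_z)$ is one in dimension $k-i-1$ for each $z\in X(i)$. For ordered $z$ and $g\in C^j(X_z,\mathcal{F}_z)$, $g^z(xz)=g(x)$, $g^z=0$ off faces containing $z$. $f\in C^k$ is locally minimal if $\|f+d_{k-1}(g^z)\|\ge\|f\|$ for all $z$ of dimension $i\in\{0..k-1\}$ and $g\in C^{k-i-2}(X_z,\mathcal{F}_z)$. ''$\beta$-expands $\gamma$-small locally minimal $k$-cochains'': $\|d_kf\|\ge\beta\|f\|$ for all locally minimal $f\in C^k$ with $\|f\|<\gamma$. *)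

(* Defs.v *)
From mathcomp Require Import all_boot all_order all_algebra all_fingroup.
From mathcomp Require Import boolp reals.

Set Implicit Arguments.
Unset Strict Implicit.
Unset Printing Implicit Defensive.

Import Order.TTheory GRing.Theory Num.Theory.
Local Open Scope ring_scope.

Section Vines.
Variable n : nat.
Implicit Types (E : {set {set 'I_n}}) (s t : {set 'I_n}).

(* In [vine], the members of the chain above s are the entries of the path c;
   each step adds one element, so the set reached after m steps has
   cardinality #|s| + m. *)
Definition vine_step E : rel {set 'I_n} :=
  fun s t => [&& t \in E, s \subset t & #|t| == #|s|.+1].

Definition vine E : bool :=
  ([set: 'I_n] \in E) &&
  [forall s in E, exists c : (n - #|s|).-tuple {set 'I_n},
     path (vine_step E) s c && (last s c == [set: 'I_n])].

Definition terminal E s : bool :=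
  (s \in E) &&
  [forall t : {set 'I_n}, (t \subset s) && (#|t|.+1 == #|s|) ==> (t \notin E)].

End Vines.

Definition U (n : nat) : nat :=
  (\max_(E : {set {set 'I_n}} | vine E) #|[set s | terminal E s]|)%N.

(* A complex is its set of faces, the empty face included; V is an ambient
   finite type, and the vertices of X are only those v with [set v] \in X. *)
Section Complexes.
Variables (R : realType) (V : finType).
Implicit Types (X S : {set {set V}}) (x z : {set V}).

Definition faces X (i : int) : {set {set V}} :=
  [set x in X | #|x|%:Z == i + 1].

Definition is_dcomplex (d : nat) X : Prop :=
  [/\ set0 \in X,
      forall x y, y \in X -> x \subset y -> x \in X
    & forall x, x \in X -> exists2 y, y \in faces X d & x \subset y].

Definition link X z : {set {set V}} :=
  [set x :\: z | x in [set x in X | z \subset x]].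

Definition weight (d : nat) X x : R :=
  ('C(d.+1, #|x|)%:R)^-1 * (#|faces X d|%:R)^-1 *
  #|[set y in faces X d | x \subset y]|%:R.

Definition weight_set (d : nat) X S : R := \sum_(x in S) weight d X x.

Definition edges_in X S : {set {set V}} :=
  [set e in faces X 1 | [forall v in faces X 0, (v \subset e) ==> (v \in S)]].

Definition skeleton_expander (d : nat) X (a : R) : Prop :=
  forall S, S \subset faces X 0 ->
    weight_set d X (edges_in X S)
      <= weight_set d X S ^+ 2 + a * weight_set d X S.

(* The link of a d-complex at z is a (d - #|z|)-complex, provided that
   #|z| <= d (which holds for the faces z considered below). *)
Definition local_skeleton_expander (d : nat) X (i : int) (a : R) : Prop :=
  forall z, z \in faces X i -> skeleton_expander (d - #|z|) (link X z) a.

End Complexes.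

(* The data of an augmented sheaf. Stalks and restriction maps are total; only
   those indexed by faces x \proper y of the complex at hand are meaningful,
   the others being unconstrained and never used. *)
Record sheaf_data (V : finType) := SheafData {
  stalk :> {set V} -> zmodType;
  res : forall x y : {set V}, {additive stalk x -> stalk y}
}.

Definition nontrivial (A : zmodType) : bool := `[< exists a : A, a != 0 >].

Definition is_augmented_sheaf (V : finType) (X : {set {set V}})
    (F : sheaf_data V) : Prop :=
  forall x y z : {set V}, z \in X -> x \proper y -> y \proper z ->
    forall a : F x, res F y z (res F x y a) = res F x z a.

(* A sheaf (on nonempty faces) is identified with the augmented sheaf that
   vanishes on the empty face. *)
Definition is_sheaf (V : finType) (X : {set {set V}})
    (F : sheaf_data V) : Prop :=
  is_augmented_sheaf X F /\ ~~ nontrivial (F set0).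

Definition link_sheaf (V : finType) (F : sheaf_data V) (z : {set V}) :
    sheaf_data V :=
  @SheafData V (fun x => F (x :|: z)) (fun x y => res F (x :|: z) (y :|: z)).

(* Cochains are indexed by the number n of vertices of a face, so that n stands
   for the cohomological dimension n - 1 and n = 0 for dimension -1.
   The value of a family at the ordered face s = (v_0, ..., v_{n-1}) with
   underlying face x is f x s : F x. Keeping x as a separate argument makes
   f x s and f x s' have the same type when s' is a reordering of s. Values f x s
   where s does not order a face x of X are irrelevant: no definition below
   depends on them. *)
Section Cochains.
Variables (R : realType) (V : finType) (d : nat) (X : {set {set V}}).
Variable F : sheaf_data V.

Definition face_family (n : nat) := forall x : {set V}, n.-tuple V -> F x.

Definition orders (n : nat) (s : n.-tuple V) (x : {set V}) : bool :=
  uniq s && ([set v in s] == x).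

Definition permute (n : nat) (p : 'S_n) (s : n.-tuple V) : n.-tuple V :=
  [tuple tnth s (p i) | i < n].

Definition omit (n : nat) (i : 'I_n.+1) (s : n.+1.-tuple V) : n.-tuple V :=
  [tuple tnth s (lift i j) | j < n].

Definition is_cochain (n : nat) (f : face_family n) : Prop :=
  forall (x : {set V}) (s : n.-tuple V) (p : 'S_n),
    x \in X -> orders s x -> f x (permute p s) = f x s *~ (-1) ^+ odd_perm p.

Definition add_family (n : nat) (f g : face_family n) : face_family n :=
  fun x s => f x s + g x s.

Definition delta (n : nat) (f : face_family n) : face_family n.+1 :=
  fun x s => \sum_(i < n.+1)
    res F (x :\ tnth s i) x (f (x :\ tnth s i) (omit i s)) *~ (-1) ^+ i.

Definition eq_cochain (n : nat) (f g : face_family n) : Prop :=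
  forall (x : {set V}) (s : n.-tuple V), x \in X -> orders s x -> f x s = g x s.

Definition is_coboundary (n : nat) : face_family n -> Prop :=
  match n with
  | 0 => fun b => eq_cochain b (fun x s => 0)
  | m.+1 => fun b => exists2 g : face_family m, is_cochain g & eq_cochain b (delta g)
  end.

Definition supp (n : nat) (f : face_family n) : {set {set V}} :=
  [set x in X | [exists s : n.-tuple V, orders s x && (f x s != 0)]].

Definition cnorm (n : nat) (f : face_family n) : R := weight_set R d X (supp f).

Definition mass (n : nat) : R :=
  weight_set R d X [set x in faces X (n%:Z - 1) | nontrivial (F x)].

(* eps-coboundary expansion in dimension n - 1; the coboundary b realizes the
   minimum of the norms of the f + b'. *)
Definition coboundary_expander (n : nat) (eps : R) : Prop :=
  forall f : face_family n, is_cochain f ->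
    exists b : face_family n,
      [/\ is_coboundary b,
          forall b' : face_family n, is_coboundary b' ->
            cnorm (add_family f b) <= cnorm (add_family f b')
        & eps * cnorm (add_family f b) * mass n.+1
            <= cnorm (delta f) * mass n].

End Cochains.

Section Local.
Variables (R : realType) (V : finType) (d : nat) (X : {set {set V}}).
Variable F : sheaf_data V.

(* i-local expansion in dimension k: expansion of the links at the i-faces in
   dimension k - i - 1, whose faces have k - i vertices; meant for i <= k. *)
Definition local_coboundary_expander (i k : nat) (eps : R) : Prop :=
  forall z : {set V}, z \in faces X i ->
    coboundary_expander (d - #|z|) (link X z) (link_sheaf F z) (k - i) eps.

(* G is the cochain g^z; it is determined by g up to eq_cochain. *)
Definition is_extension (m p n : nat) (z : p.-tuple V)
    (g : face_family (link_sheaf F [set v in z]) m) (G : face_family F n) : Prop :=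
  let zs := [set v in z] in
  [/\ is_cochain X G,
      forall (x : {set V}) (t : m.-tuple V) (s : n.-tuple V),
        x \in link X zs -> orders t x -> s = t ++ z :> seq V ->
        G (x :|: zs) s = g x t
    & forall (y : {set V}) (s : n.-tuple V),
        y \in X -> orders s y -> ~~ (zs \subset y) -> G y s = 0].

(* Here f has dimension k, z has dimension i, g has dimension k - i - 2 (hence
   lives on faces with k - (i + 1) vertices) and G = g^z has dimension k - 1. *)
Definition locally_minimal (k : nat) (f : face_family F k.+1) : Prop :=
  forall (i : nat) (z : i.+1.-tuple V), (i < k)%N ->
    uniq z -> [set v in z] \in X ->
  forall (g : face_family (link_sheaf F [set v in z]) (k - i.+1)) (G : face_family F k),
    is_cochain (link X [set v in z]) g -> is_extension g G ->
    cnorm R d X f <= cnorm R d X (add_family f (delta G)).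

Definition expands_small_locally_minimal (k : nat) (beta gamma : R) : Prop :=
  forall f : face_family F k.+1, is_cochain X f -> locally_minimal f ->
    cnorm R d X f < gamma ->
    beta * cnorm R d X f <= cnorm R d X (delta f).

End Local.

(* Main.v *)
(* Call a face fat by descending induction on its dimension: a k-face is fat if
   it lies in the support of f, and a smaller face z is fat if the vertices v of
   its link with z + v fat have weight at least h in the link. Smallness of f
   makes the empty face thin. Descending from a face along fat facets ends in
   its terminal faces, all of them nonempty. At a terminal face z, f induces a
   cochain f_z on the link of z, supported on the k-faces having z as a terminal
   face; local minimality makes f_z minimal in its coboundary class, so the
   coboundary expansion of the link bounds the norm of d f_z below. If z is the
   only terminal face of a (k+1)-face y, then d f and d f_z agree at y.

   A (k+1)-face y with several terminal faces has to contain, for each of them,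
   two fat facets s, t of a common face with s & t thin; so y has at most twice
   as many terminal faces as it contains such pairs {s, t}. Skeleton expansion
   of the link of the thin face s & t bounds the total weight of these pairs.
   Counting pairs instead of bad faces costs a factor |s + t| <= k + 2, and
   k + 2 <= U(k + 2). *)
Require Import Defs.
From mathcomp Require Import all_boot all_order all_algebra all_fingroup.
From mathcomp Require Import unstable boolp reals zify ring.

Set Implicit Arguments.
Unset Strict Implicit.
Unset Printing Implicit Defensive.

Import Order.TTheory GRing.Theory Num.Theory.
Local Open Scope ring_scope.

(** * Faces, links and canonical weights *)

Lemma card_subsets_between (V : finType) (x t : {set V}) n :
  x \subset t -> (#|x| <= n)%N ->
  #|[set y : {set V} | [&& x \subset y, y \subset t & #|y| == n]]|
    = 'C(#|t| - #|x|, n - #|x|).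
Proof.
move=> xt xn; rewrite -(cardsDS xt) -cards_draws.
rewrite -(@card_in_imset _ _ (fun y => y :\: x)
  [set y : {set V} | [&& x \subset y, y \subset t & #|y| == n]]); last first.
  move=> y1 y2; rewrite !inE => /andP[xy1 _] /andP[xy2 _] e.
  by rewrite -(setID y1 x) -(setID y2 x) e (setIidPr xy1) (setIidPr xy2).
apply: eq_card => b; rewrite inE; apply/imsetP/andP.
  case=> y; rewrite inE => /and3P[xy yt /eqP <-] ->.
  by rewrite setSD // cardsDS.
case=> bt /eqP cb; exists (b :|: x).
  rewrite inE subsetUr subUset xt (subset_trans bt) ?subsetDl //=.
  have: [disjoint b & x] by move: bt; rewrite subsetD => /andP[].
  by move=> /disjoint_setI0 e; rewrite cardsU e cards0 subn0 cb subnK.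
rewrite setDUl setDv setU0; apply/esym/setDidPl.
by move: bt; rewrite subsetD => /andP[].
Qed.

Lemma bin_trinomial (m n p : nat) : (p <= n)%N -> (n <= m)%N ->
  ('C(m, n) * 'C(n, p) = 'C(m, p) * 'C(m - p, n - p))%N.
Proof.
move=> pn nm; have pm := leq_trans pn nm.
have f0 : (0 < p`! * (n - p)`! * (m - n)`!)%N by rewrite !muln_gt0 !fact_gt0.
apply/eqP; rewrite -(eqn_pmul2r f0); apply/eqP.
transitivity (m`!)%N.
  by rewrite -(bin_fact nm) -(bin_fact pn); lia.
have le : (n - p <= m - p)%N by rewrite leq_sub2r.
rewrite -(bin_fact pm) -(bin_fact le).
have -> : (m - p - (n - p) = m - n)%N by lia.
lia.
Qed.

(** Indexing by the number of vertices keeps dimension -1 inside [nat]: n stands for dimension n -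
    1. *)
Definition nfaces (V : finType) (X : {set {set V}}) n := [set x in X | #|x| == n].

Lemma facesS (V : finType) (X : {set {set V}}) n : faces X n%:Z = nfaces X n.+1.
Proof. by apply/setP=> x; rewrite !inE; congr (_ && _); lia. Qed.

Lemma faces_subr1 (V : finType) (X : {set {set V}}) n :
  faces X (n%:Z - 1) = nfaces X n.
Proof. by apply/setP=> x; rewrite !inE; congr (_ && _); lia. Qed.

Lemma setDKU (V : finType) (y z : {set V}) : z \subset y -> y :\: z :|: z = y.
Proof. by move=> zy; rewrite -{2}(setID y z) (setIidPr zy) setUC. Qed.

Lemma setUDK (V : finType) (x z : {set V}) : [disjoint x & z] -> (x :|: z) :\: z = x.
Proof. by move=> dxz; rewrite setDUl setDv setU0; apply/setDidPl. Qed.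

Lemma disjointDl (V : finType) (y z : {set V}) : [disjoint y :\: z & z].
Proof. by rewrite -setI_eq0 setDE -setIA (setIC _ z) setICr setI0. Qed.

(** Transports a set of faces of the link back to the star of z, where it can be weighed against
    other sets of faces of X. *)
Definition lift_faces (V : finType) (X : {set {set V}}) (z : {set V})
    (S : {set {set V}}) :=
  [set y in X | (z \subset y) && (y :\: z \in S)].

Lemma linkE (V : finType) (X : {set {set V}}) (x z : {set V}) :
  (x \in link X z) = [disjoint x & z] && (x :|: z \in X).
Proof.
apply/imsetP/andP => [[y] | [dxz Xxz]].
  by rewrite inE => /andP[yX zy] ->; rewrite disjointDl setDKU.
by exists (x :|: z); rewrite ?setUDK // inE Xxz subsetUr.
Qed.

Lemma card_disjointU (V : finType) (x z : {set V}) :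
  [disjoint x & z] -> #|x :|: z| = (#|x| + #|z|)%N.
Proof. by move=> /disjoint_setI0 e; rewrite cardsU e cards0 subn0. Qed.

Section Weights.
Variables (R : realType) (V : finType) (d : nat) (X : {set {set V}}).
Hypothesis Xd : is_dcomplex d X.
Local Notation w := (weight R d X).
Local Notation W := (weight_set R d X).
Implicit Types (x y z : {set V}) (S T : {set {set V}}).

Lemma face_subset x y : y \in X -> x \subset y -> x \in X.
Proof. by case: Xd => _ H _; apply: H. Qed.

Lemma face_card_le x : x \in X -> (#|x| <= d.+1)%N.
Proof.
case: Xd => _ _ H /H[y]; rewrite facesS inE => /andP[_ /eqP <-].
exact: subset_leq_card.
Qed.

(** The weight of x before normalisation, kept in [nat] for the double counting below. *)
Definition ntop x := #|[set t in faces X d | x \subset t]|.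

Lemma ntop_gt0 x : x \in X -> (0 < ntop x)%N.
Proof.
case: Xd => _ _ H /H[y yt xy]; apply/card_gt0P; exists y.
by rewrite inE yt xy.
Qed.

Lemma ntop_set0 : ntop set0 = #|faces X d|.
Proof. by apply: eq_card => t; rewrite inE sub0set andbT. Qed.

Lemma faces_top_gt0 : (0 < #|faces X d|)%N.
Proof. by rewrite -ntop_set0 ntop_gt0 //; case: Xd. Qed.

Lemma weight_ge0 x : 0 <= w x.
Proof. by rewrite /weight !mulr_ge0 // ?invr_ge0 ?ler0n. Qed.

Lemma weight_gt0 x : x \in X -> 0 < w x.
Proof.
move=> xX; rewrite /weight !mulr_gt0 // ?invr_gt0 ?ltr0n ?bin_gt0.
- exact: face_card_le.
- exact: faces_top_gt0.
- exact: ntop_gt0.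
Qed.

Lemma weight_set_ge0 S : 0 <= W S.
Proof. by apply: sumr_ge0 => x _; apply: weight_ge0. Qed.

Lemma weight_set_sub S T : S \subset T -> W S <= W T.
Proof.
move=> ST; rewrite /weight_set (big_setID S (A := T)) /= (setIidPr ST).
by rewrite lerDl; apply: sumr_ge0 => x _; apply: weight_ge0.
Qed.

(** Double counting of pairs y, t with y between x and the d-face t: every n-set between x and t is
    a face, and their number is the binomial coefficient. *)
Lemma sum_ntop x n : (#|x| <= n)%N ->
  (\sum_(y in nfaces X n | x \subset y) ntop y
     = ntop x * 'C(d.+1 - #|x|, n - #|x|))%N.
Proof.
move=> xn.
have -> : (\sum_(y in nfaces X n | x \subset y) ntop y =
   \sum_(y in nfaces X n | x \subset y)
     \sum_(t in faces X d | x \subset t) nat_of_bool (y \subset t))%N.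
  apply: eq_bigr => y /andP[_ xy].
  rewrite /ntop -sum1_card (eq_bigl (fun t => (t \in faces X d) && (y \subset t)));
    last by move=> t; rewrite inE.
  rewrite [RHS](bigID (fun t : {set V} => y \subset t)) /= [X in (_ + X)%N]big1 ?addn0.
    apply: eq_big => [t|t /andP[_ ->]] //.
    by case E: (y \subset t); rewrite ?andbF ?andbT // (subset_trans xy E) andbT.
  by move=> t /andP[_ /negbTE ->].
rewrite exchange_big /= /ntop -sum1dep_card big_distrl /=.
apply: eq_bigr => t /andP[]; rewrite facesS inE => /andP[tX /eqP ct] xt.
rewrite mul1n -ct -card_subsets_between // -sum1dep_card.
rewrite -big_mkcondr /=; apply: eq_bigl => y.
rewrite inE; case: (boolP (y \subset t)) => yt; rewrite ?andbF //=.
by rewrite (face_subset tX yt) andbT andbC.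
Qed.

Lemma weight_upward x n : (#|x| <= n)%N -> (n <= d.+1)%N ->
  \sum_(y in nfaces X n | x \subset y) w y = 'C(n, #|x|)%:R * w x.
Proof.
move=> xn nd.
transitivity (\sum_(y in nfaces X n | x \subset y)
    ('C(d.+1, n)%:R^-1 * #|faces X d|%:R^-1 : R) * (ntop y)%:R).
  by apply: eq_bigr => y /andP[]; rewrite inE => /andP[_ /eqP cy] _; rewrite /weight cy.
rewrite -big_distrr /= -natr_sum sum_ntop // /weight -/(ntop x).
have b1 : ('C(d.+1, n)%:R : R) != 0 by rewrite pnatr_eq0 -lt0n bin_gt0.
have b2 : ('C(d.+1, #|x|)%:R : R) != 0.
  by rewrite pnatr_eq0 -lt0n bin_gt0 (leq_trans xn).
have b3 : (#|faces X d|%:R : R) != 0 by rewrite pnatr_eq0 -lt0n faces_top_gt0.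
have := bin_trinomial xn nd => /(congr1 (fun i => i%:R : R)); rewrite !natrM => E.
apply: (mulfI b1); apply: (mulfI b2).
transitivity ((ntop x)%:R * ('C(d.+1, #|x|)%:R * 'C(d.+1 - #|x|, n - #|x|)%:R)
   / #|faces X d|%:R : R); first by field; rewrite b1 b3.
by rewrite -E; field; rewrite b2 b3.
Qed.

Lemma weight_set0 : w set0 = 1.
Proof.
rewrite /weight cards0 bin0 invr1 mul1r -/(ntop set0) ntop_set0 mulVf //.
by rewrite pnatr_eq0 -lt0n faces_top_gt0.
Qed.

Lemma card_link_top x z : (#|z| <= d)%N -> [disjoint x & z] ->
  #|[set y in faces (link X z) (d - #|z|)%N | x \subset y]| = ntop (x :|: z).
Proof.
move=> zd dxz.
rewrite -(@card_in_imset _ _ (fun y => y :|: z)); last first.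
  move=> y1 y2; rewrite !inE !linkE => /andP[/andP[/andP[d1 _] _] _].
  move=> /andP[/andP[/andP[d2 _] _] _] e.
  by rewrite -(setUDK d1) e setUDK.
apply: eq_card => t; apply/imsetP/idP.
  case=> y; rewrite !inE linkE => /andP[/andP[/andP[dyz yX] /eqP cy] xy] ->.
  by rewrite yX setSU // andbT /= card_disjointU //; apply/eqP; lia.
rewrite !inE => /andP[/andP[tX /eqP ct]]; rewrite subUset => /andP[xt zt].
exists (t :\: z); last by rewrite setDKU.
rewrite !inE linkE setDKU // tX cardsDS // subsetD xt dxz !andbT.
by rewrite disjointDl /=; lia.
Qed.

(** The d-faces of X above x :|: z correspond to the top faces of the link above x, so the two
    weights differ only by their normalisations, whose ratio is [w z] times a binomial
    coefficient. *)
Lemma weight_link x z : (#|z| <= d)%N -> x \in link X z ->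
  w (x :|: z) = 'C(#|x| + #|z|, #|z|)%:R * w z * weight R (d - #|z|) (link X z) x.
Proof.
move=> zd xl; move: (xl); rewrite linkE => /andP[dxz xzX].
have zX : z \in X by apply: face_subset xzX (subsetUr _ _).
rewrite /weight card_link_top // -/(ntop z) -/(ntop _).
have -> : #|faces (link X z) (d - #|z|)%N| = ntop z.
  rewrite -[in RHS](set0U z) -card_link_top //; last by rewrite -setI_eq0 set0I.
  by apply: eq_card => t; rewrite inE sub0set andbT.
have cxz := card_disjointU dxz; have := face_card_le xzX; rewrite cxz => le.
rewrite -subSn //.
have b0 : ((ntop z)%:R : R) != 0 by rewrite pnatr_eq0 -lt0n ntop_gt0.
have b1 : ('C(d.+1, #|x| + #|z|)%:R : R) != 0 by rewrite pnatr_eq0 -lt0n bin_gt0.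
have b2 : ('C(d.+1, #|z|)%:R : R) != 0.
  by rewrite pnatr_eq0 -lt0n bin_gt0 (leq_trans _ le) // leq_addl.
have b3 : ('C(d.+1 - #|z|, #|x|)%:R : R) != 0.
  by rewrite pnatr_eq0 -lt0n bin_gt0 -(leq_add2r #|z|) subnK // (leq_trans zd).
have b4 : (#|faces X d|%:R : R) != 0 by rewrite pnatr_eq0 -lt0n faces_top_gt0.
have := @bin_trinomial d.+1 (#|x| + #|z|) #|z| (leq_addl _ _) le.
rewrite addnK => /(congr1 (fun i => i%:R : R)); rewrite !natrM => E.
apply: (mulfI b1).
transitivity ((ntop (x :|: z))%:R / #|faces X d|%:R : R); first by field; rewrite b1 b4.
transitivity (('C(d.+1, #|x| + #|z|)%:R * 'C(#|x| + #|z|, #|z|)%:R)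
  / 'C(d.+1, #|z|)%:R / 'C(d.+1 - #|z|, #|x|)%:R * (ntop (x :|: z))%:R / #|faces X d|%:R : R);
  last by field; rewrite b0 b2 b3 b4.
by rewrite E; field; rewrite b2 b3 b4.
Qed.

Lemma weight_lift_faces z n S : (#|z| <= d)%N -> S \subset nfaces (link X z) n ->
  W (lift_faces X z S)
    = 'C(n + #|z|, #|z|)%:R * w z * weight_set R (d - #|z|) (link X z) S.
Proof.
move=> zd Sn; rewrite /weight_set big_distrr /=.
have liftS : lift_faces X z S = [set x :|: z | x in S].
  apply/setP=> y; rewrite inE; apply/idP/imsetP.
    by move=> /and3P[_ zy yS]; exists (y :\: z); rewrite ?setDKU.
  case=> x xS ->; have := subsetP Sn _ xS; rewrite inE linkE.
  by move=> /andP[/andP[dxz ->] _]; rewrite subsetUr setUDK.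
rewrite liftS big_imset /=; last first.
  move=> x1 x2 /(subsetP Sn); rewrite inE linkE => /andP[/andP[d1 _] _].
  move=> /(subsetP Sn); rewrite inE linkE => /andP[/andP[d2 _] _] e.
  by rewrite -(setUDK d1) e setUDK.
apply: eq_bigr => x /(subsetP Sn); rewrite inE => /andP[xl /eqP cx].
by rewrite weight_link // cx.
Qed.

End Weights.

(** * Fat faces and terminal faces *)

Section Terminals.
Variables (V : finType) (fatp : pred {set V}).
Implicit Types (s t u x y z : {set V}).

(** Only the target has to be fat, so that a (k+1)-face, which is never fat, can start a descent
    into the support of f. *)
Definition fat_step : rel {set V} :=
  fun s t => [&& t \subset s, #|s| == #|t|.+1 & fatp t].

Definition terminals y : {set {set V}} :=
  [set z | [&& connect fat_step y z, fatp z & ~~ [exists t, fat_step z t]]].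

Lemma terminals_fat y z : z \in terminals y -> fatp z.
Proof. by rewrite inE => /and3P[]. Qed.

Lemma terminals_subset y z : z \in terminals y -> z \subset y.
Proof.
rewrite inE => /and3P[/connectP[p pth ->] _ _].
elim: p y pth => //= t p IH y /andP[/and3P[ty _ _]] /IH/subset_trans; exact.
Qed.

Lemma terminals_step y x : fat_step y x -> terminals x \subset terminals y.
Proof.
move=> st; apply/subsetP=> z; rewrite !inE => /and3P[xz -> ->].
by rewrite (connect_trans (connect1 st) xz).
Qed.

Lemma terminals_inv y z : z \in terminals y ->
  (z = y /\ ~~ [exists t, fat_step y t])
  \/ exists2 x, fat_step y x & z \in terminals x.
Proof.
rewrite inE => /and3P[/connectP[[|x p] /= pth ->] fz tz]; first by left.
case/andP: pth => st pth; right; exists x; rewrite // inE fz tz !andbT.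
by apply/connectP; exists p.
Qed.

Lemma terminals_neq0 x : fatp x -> exists z, z \in terminals x.
Proof.
have [n] := ubnP #|x|; elim: n x => // n IH x xn fx.
have [/existsP[t st]|nst] := boolP [exists t, fat_step x t].
  have [|z zt] := IH t _ (proj2 (andP (proj2 (andP st)))).
    by case/and3P: st => _ /eqP cx _; move: cx xn; clear; lia.
  by exists z; apply: subsetP zt; apply: terminals_step.
by exists x; rewrite inE connect0 fx nst.
Qed.

(** A bad pair s, t is charged with the terminals chosen for s and t, hence with at most two faces.
    The default [set0] covers the absence of terminals. *)
Definition chosen_terminal s := odflt set0 [pick z in terminals s].

Lemma chosen_terminal_unique s z :
  z \in terminals s -> terminals s \subset [set z] -> chosen_terminal s = z.
Proof.
move=> zs /subsetP sub; rewrite /chosen_terminal; case: pickP => [x /sub|/(_ z)].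
  by rewrite inE => /eqP.
by rewrite zs.
Qed.

(* Descent along fat faces is confluent away from the pairs s, t found here;
   two distinct terminals of y therefore force such a pair, and one whose
   first member has the given z as its only terminal. *)
Lemma terminals_bad_pair y z : z \in terminals y -> (1 < #|terminals y|)%N ->
  exists s t, [/\ fatp s, fatp t, ~~ fatp (s :&: t) & s :|: t \subset y]
    /\ [/\ #|s| = #|s :&: t|.+1, #|t| = #|s :&: t|.+1 & chosen_terminal s = z].
Proof.
move=> zy card_gt1; apply: contrapT => nobad.
(* Without such a pair, any u below y having z as a terminal has no other one; for u = y this
   contradicts the cardinality. *)
suff sub : forall u, u \subset y -> z \in terminals u -> terminals u \subset [set z].
  by have := subset_leq_card (sub y (subxx _) zy); rewrite cards1 leqNgt card_gt1.
move=> u; have [n] := ubnP #|u|; elim: n u => // n IH u un uy zu.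
have [[zE nst]|[s ss zs]] := terminals_inv zu.
  apply/subsetP=> x /terminals_inv[[-> _]|[t st _]]; first by rewrite zE inE.
  by case/negP: nst; apply/existsP; exists t.
have smaller t : fat_step u t -> (#|t| < n)%N /\ t \subset y.
  case/and3P=> tu /eqP cu _; split; first by move: cu un; clear; lia.
  exact: subset_trans tu uy.
have [sn sy] := smaller s ss.
have ts := IH s sn sy zs.
apply/subsetP=> x /terminals_inv[[_]|[t st xt]].
  by case/negP; apply/existsP; exists s.
have [tn ty] := smaller t st.
have [eq_st|neq_st] := eqVneq s t; first by apply: (subsetP ts); rewrite eq_st.
case/and3P: (ss) => su /eqP cs fs; case/and3P: (st) => tu /eqP ct ft.
have sUt : s :|: t = u.
  apply/eqP; rewrite eqEcard subUset su tu /=.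
  have : s \proper s :|: t.
    rewrite properEneq subsetUl andbT; apply: contra neq_st => /eqP e.
    have ts' : t \subset s by rewrite e subsetUr.
    by rewrite eq_sym eqEcard ts' /=; move: cs ct; clear; lia.
  by move/proper_card; move: cs ct; clear; lia.
have := cardsUI s t; rewrite sUt => cI.
have csI : #|s| = #|s :&: t|.+1 by move: cI cs ct; clear; lia.
have ctI : #|t| = #|s :&: t|.+1 by move: cI cs ct; clear; lia.
(* A terminal of the fat face s :&: t is one of s, hence is z by induction; so z is a terminal of t,
   and the induction hypothesis applies to t. *)
have [fI|nfI] := boolP (fatp (s :&: t)).
  have [v vI] := terminals_neq0 fI.
  have sI : fat_step s (s :&: t) by rewrite /fat_step subsetIl csI eqxx fI.
  have tI : fat_step t (s :&: t) by rewrite /fat_step subsetIr ctI eqxx fI.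
  have := subsetP ts _ (subsetP (terminals_step sI) _ vI).
  rewrite inE => /eqP vz; rewrite vz in vI.
  exact: (subsetP (IH t tn ty (subsetP (terminals_step tI) _ vI))).
case: nobad; exists s, t; split; split=> //; first by rewrite sUt.
exact: chosen_terminal_unique.
Qed.

End Terminals.

(** * Weights of fat faces and of bad pairs *)

Section Fat.
Variables (R : realType) (V : finType) (d : nat) (X : {set {set V}}).
Hypothesis Xd : is_dcomplex d X.
Local Notation w := (weight R d X).
Local Notation W := (weight_set R d X).
Variables (k : nat) (S : {set {set V}}) (H a : nat -> R).
Hypothesis kd : (k.+1 <= d)%N.
Hypothesis SX : S \subset nfaces X k.+1.
Hypothesis H_gt0 : forall n, (n <= k)%N -> 0 < H n.
Hypothesis a_ge0 : forall n, (n <= k)%N -> 0 <= a n.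
Hypothesis skel : forall n z, (n <= k)%N -> z \in nfaces X n ->
  skeleton_expander (d - #|z|) (link X z) (a n).
Hypothesis S_small : W S < \prod_(0 <= j < k.+1) H j.
Implicit Types (x y z : {set V}).

Definition weight_above (T : {set {set V}}) x : R := \sum_(s in T | x \subset s) w s.

(** The recursion is on the codimension: for m at most k + 1, [fat_rec m] has faces with n = k + 1 -
    m vertices. A vertex v of the link of x satisfies w (v :|: x) = (n + 1) * w x * (weight of v in
    the link), which turns the threshold H n in the link into the one used here. *)
Fixpoint fat_rec m : {set {set V}} :=
  if m is m'.+1 then
    [set x in nfaces X (k - m')%N |
       H (k - m')%N * w x * (k - m').+1%:R <= weight_above (fat_rec m') x]
  else S.

(* The fat faces with n vertices; the value for n > k + 1 is S and has no
   meaning. S stands for the support of a k-cochain. *)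
Definition fat n := fat_rec (k.+1 - n).

Lemma fat_top : fat k.+1 = S.
Proof. by rewrite /fat subnn. Qed.

Lemma fatE n x : (n <= k)%N ->
  (x \in fat n) = (x \in nfaces X n) &&
    (H n * w x * n.+1%:R <= weight_above (fat n.+1) x).
Proof. by move=> nk; rewrite /fat subSn //= inE subSS subKn. Qed.

Lemma fat_nfaces n : (n <= k.+1)%N -> fat n \subset nfaces X n.
Proof.
rewrite leq_eqVlt => /orP[/eqP -> | nk]; first by rewrite fat_top.
by apply/subsetP=> x; rewrite fatE // => /andP[].
Qed.

Definition fatp : pred {set V} := fun x => x \in fat #|x|.

Lemma fatp_card x : fatp x -> (#|x| <= k.+1)%N /\ x \in X.
Proof.
rewrite /fatp; have [le|gt] := leqP #|x| k.+1.
  by move/(subsetP (fat_nfaces le)); rewrite inE => /andP[].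
(* Beyond k + 1 vertices, truncated subtraction makes [fat] equal to S, whose members have exactly k
   + 1 vertices. *)
have -> : fat #|x| = S by rewrite /fat (eqP (ltnW gt : (k.+1 - #|x|)%N == 0)).
by move/(subsetP SX); rewrite inE => /andP[-> /eqP e]; move: gt; rewrite e ltnn.
Qed.

(** Each member of T has n + 1 subsets of size n, so the left side counts it at most n + 1 times. *)
Lemma sum_weight_above n (T P : {set {set V}}) :
  T \subset nfaces X n.+1 -> P \subset nfaces X n ->
  \sum_(x in P) weight_above T x <= n.+1%:R * W T.
Proof.
move=> TX PX; rewrite (exchange_big_dep (mem T)) /=; last by move=> ? ? _ /andP[].
rewrite /weight_set big_distrr /=.
apply: ler_sum => s sT; rewrite sumr_const -[X in X <= _]mulr_natl.
rewrite ler_wpM2r ?weight_ge0 // ler_nat.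
have := subsetP TX _ sT; rewrite inE => /andP[_ /eqP cs].
rewrite -[X in (_ <= X)%N](binSn n) -cs -cards_draws subset_leq_card //.
apply/subsetP=> x; rewrite !inE => /andP[/(subsetP PX)].
by rewrite inE => /andP[_ ->] /andP[_ ->].
Qed.

(** Sum the inequality defining fatness over [fat n] and apply [sum_weight_above]; the factors n + 1
    cancel. *)
Lemma weight_fat_step n : (n <= k)%N -> H n * W (fat n) <= W (fat n.+1).
Proof.
move=> nk; rewrite -(ler_pM2l (ltr0Sn R n)).
apply: le_trans (sum_weight_above (fat_nfaces _) (fat_nfaces _)); rewrite ?ltnS //;
  last exact: leqW.
rewrite /weight_set !big_distrr /=; apply: ler_sum => x.
by rewrite fatE // => /andP[_]; rewrite mulrC.
Qed.

(** Iterates [weight_fat_step] up to the support. The case n = 0 makes the empty face thin; the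
    cases n > 0 give the denominators of the final estimate. *)
Lemma weight_fat n : (n <= k.+1)%N -> (\prod_(n <= j < k.+1) H j) * W (fat n) <= W S.
Proof.
move=> nk; rewrite -(subKn nk); elim: (k.+1 - n)%N (leq_subr n k.+1) => [_|m IH mk].
  by rewrite subn0 big_geq // mul1r fat_top.
have lt : (k.+1 - m.+1 < k.+1)%N by clear; lia.
rewrite big_ltn // mulrAC mulrC mulrA; apply: le_trans (IH (ltnW mk)).
have -> : (k.+1 - m = (k.+1 - m.+1).+1)%N by move: mk; clear; lia.
rewrite -mulrA; apply: ler_wpM2l; last by apply: weight_fat_step; move: mk; clear; lia.
rewrite big_nat; apply: prodr_ge0 => j /andP[_ jk]; exact/ltW/H_gt0.
Qed.

Lemma set0_not_fat : ~~ fatp set0.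
Proof.
apply/negP=> f0; have := weight_fat (leq0n _); apply/negP; rewrite -ltNge.
apply: lt_le_trans S_small _; rewrite -[X in X <= _]mulr1.
apply: ler_wpM2l.
  by rewrite big_nat; apply: prodr_ge0 => j /andP[_ jk]; exact/ltW/H_gt0.
rewrite -(weight_set0 R Xd) /weight_set.
rewrite (big_setD1 set0) /=; last by move: f0; rewrite /fatp cards0.
by rewrite lerDl; apply: sumr_ge0 => x _; apply: weight_ge0.
Qed.

Definition fat_vertices z : {set {set V}} :=
  [set v in nfaces (link X z) 1 | fatp (v :|: z)].

(** An edge e here encodes the two fat facets of e :|: z that meet in z; for thin z these are the
    bad pairs. *)
Definition fat_edges z := edges_in (link X z) (fat_vertices z).

Lemma fat_edges_nfaces z : fat_edges z \subset nfaces (link X z) 2.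
Proof. by apply/subsetP=> e; rewrite inE facesS => /andP[]. Qed.

Lemma lift_fat_vertices z : lift_faces X z (fat_vertices z) =
  [set s in fat #|z|.+1 | z \subset s] :&: nfaces X #|z|.+1.
Proof.
apply/setP=> s; rewrite !inE linkE; have [zs|] := boolP (z \subset s); last first.
  by rewrite !andbF.
rewrite setDKU // cardsDS // !andbT disjointDl /=; have := subset_leq_card zs => le.
have [sX|] := boolP (s \in X); rewrite ?andbF //=.
have -> : (#|s| - #|z| == 1)%N = (#|s| == #|z|.+1) by move: le; clear; lia.
by have [e|] := eqVneq #|s| #|z|.+1; rewrite ?andbF //= /fatp e andbT.
Qed.

(** Let p be the weight of the fat vertices in the link. Thinness gives p <= H n, so skeleton
    expansion bounds the weight of the fat edges by (a n + H n) * p. Lifting to X multiplies edge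
    weights by 'C(n + 2, 2) * w z and vertex weights by (n + 1) * w z. *)
Lemma weight_fat_edges n z : (n <= k)%N -> z \in nfaces X n -> z \notin fat n ->
  2 * \sum_(e in fat_edges z) w (e :|: z)
    <= n.+2%:R * (a n + H n) * weight_above (fat n.+1) z.
Proof.
move=> nk zn nfat; have := zn; rewrite inE => /andP[zX /eqP cz].
have zd : (#|z| <= d)%N by rewrite cz; apply: leq_trans (leq_trans nk (leqnSn k)) kd.
have w0 := weight_gt0 R Xd zX.
have qE : weight_above (fat n.+1) z = n.+1%:R * w z *
    weight_set R (d - #|z|) (link X z) (fat_vertices z).
  have := weight_lift_faces R Xd zd (n := 1) (S := fat_vertices z).
  rewrite lift_fat_vertices cz add1n binSn => <-; last first.
    by apply/subsetP=> v; rewrite inE => /andP[].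
  rewrite /weight_above /weight_set; apply: eq_bigl => s; rewrite !inE.
  have [sf|//] := boolP (s \in fat n.+1).
  by have := subsetP (fat_nfaces (nk : (n.+1 <= k.+1)%N)) _ sf; rewrite inE => ->; rewrite andbT.
set p := weight_set R (d - #|z|) (link X z) (fat_vertices z) in qE *.
have p0 : 0 <= p by apply: sumr_ge0 => v _; apply: weight_ge0.
have pH : p <= H n.
  move: nfat; rewrite fatE // zn /= -ltNge qE => /ltW.
  have -> : H n * w z * n.+1%:R = n.+1%:R * w z * H n by ring.
  by rewrite ler_pM2l // mulr_gt0 // ltr0Sn.
have sk : weight_set R (d - #|z|) (link X z) (fat_edges z) <= p * (a n + H n).
  apply: le_trans (skel nk zn _) _.
    by apply/subsetP=> v; rewrite facesS inE => /andP[].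
  by rewrite -/p mulrDr addrC [p * a n]mulrC lerD2l expr2 ler_wpM2l.
have -> : \sum_(e in fat_edges z) w (e :|: z)
   = 'C(n.+2, 2)%:R * w z * weight_set R (d - #|z|) (link X z) (fat_edges z).
  rewrite /weight_set big_distrr /=; apply: eq_bigr => e.
  move/(subsetP (fat_edges_nfaces z)); rewrite inE => /andP[el /eqP ce].
  by rewrite weight_link // ce cz add2n -[in 'C(n.+2, n)](@bin_sub n.+2 n) ?subSn ?subnn // leqW.
have b2 : 2 * 'C(n.+2, 2)%:R = n.+2%:R * n.+1%:R :> R.
  by rewrite -!natrM -(mul_bin_diag n.+2 1) bin1.
rewrite qE 2!mulrA b2.
have c0 : 0 <= n.+2%:R * n.+1%:R * w z by apply: mulr_ge0; [apply: mulr_ge0 | exact: ltW].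
by apply: le_trans (ler_wpM2l c0 sk) _; rewrite le_eqVlt; apply/orP; left; apply/eqP; ring.
Qed.

(** Each bad pair inside y counts twice, once for each chosen terminal charged to it. *)
Definition nbad y : nat :=
  (\sum_(i < k.+1) \sum_(z in nfaces X i :\: fat i)
     \sum_(e in fat_edges z | e :|: z \subset y) 2)%N.

Lemma card_terminals y : y \in X ->
  (1 < #|terminals fatp y|)%N -> (#|terminals fatp y| <= nbad y)%N.
Proof.
move=> yX gt1.
(* [C z e] holds the terminals chosen for the two facets of e :|: z that contain z. *)
pose C z (e : {set V}) : {set {set V}} := [set chosen_terminal fatp (v :|: z)
                 | v in [set v : {set V} | (v \subset e) && (#|v| == 1%N)]].
have sub : terminals fatp y \subset
  \bigcup_(i < k.+1) \bigcup_(z in nfaces X i :\: fat i)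
     \bigcup_(e in fat_edges z | e :|: z \subset y) C z e.
  apply/subsetP=> t /terminals_bad_pair/(_ gt1)[s [u [[fs fu nf suy] [cs cu st]]]].
  set z := s :&: u in nf cs cu *.
  have [sk sX] := fatp_card fs.
  have zk : (#|z| < k.+1)%N by rewrite -ltnS -cs.
  have zs : z \subset s := subsetIl _ _.
  have zu : z \subset u := subsetIr _ _.
  have suX : s :|: u \in X by exact: (face_subset Xd yX suy).
  have zX : z \in X by exact: (face_subset Xd sX zs).
  have csu := cardsUI s u.
  have zsu : z \subset s :|: u by apply: subset_trans zs (subsetUl _ _).
  apply/bigcupP; exists (Ordinal zk) => //.
  apply/bigcupP; exists z; first by rewrite in_setD (nf : z \notin fat #|z|) inE zX eqxx.
  apply/bigcupP; exists ((s :|: u) :\: z); last first.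
    apply/imsetP; exists (s :\: z); last by rewrite setDKU.
    by rewrite inE setSD ?subsetUl //= cardsDS // cs subSnn.
  rewrite setDKU // suy andbT inE facesS inE linkE setDKU // suX disjointDl /=.
  rewrite cardsDS //; apply/andP; split; first by move: csu cs cu; rewrite -/z; clear; lia.
  apply/forall_inP=> v; rewrite facesS => vf; apply/implyP=> ve.
  rewrite inE vf /=; move: vf; rewrite inE => /andP[_ /cards1P[b vb]].
  move: ve; rewrite vb sub1set inE => /andP[bz].
  have aux (r : {set V}) : b \in r -> z \subset r -> #|r| = #|z|.+1 -> [set b] :|: z = r.
    move=> br zr cr; apply/eqP; rewrite eqEcard subUset sub1set br zr /=.
    by rewrite cardsU1 bz cr.
  by rewrite inE => /orP[bs|bu]; [rewrite (aux s) | rewrite (aux u)].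
apply: leq_trans (subset_leq_card sub) _.
apply: leq_trans (card_big_setU _ _ _) _; apply: leq_sum => i _.
apply: leq_trans (card_big_setU _ _ _) _; apply: leq_sum => z _.
apply: leq_trans (card_big_setU _ _ _) _; apply: leq_sum => e /andP[ef _].
apply: leq_trans (leq_imset_card _ _) _.
move/(subsetP (fat_edges_nfaces z)): ef; rewrite inE => /andP[_ /eqP ce].
by rewrite cards_draws ce.
Qed.

(** After interchanging the sums, a bad pair with union e :|: z collects the weight of all y above
    it, which is 'C(k + 2, i + 2) * w (e :|: z) by [weight_upward]; then [weight_fat_edges] and
    [sum_weight_above] apply. *)
Lemma sum_nbad : \sum_(y in nfaces X k.+2) w y * (nbad y)%:R <=
  k.+2%:R * \sum_(0 <= i < k.+1)
     'C(k.+2, i.+2)%:R * i.+1%:R * ((a i + H i) * W (fat i.+1)).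
Proof.
have -> : \sum_(y in nfaces X k.+2) w y * (nbad y)%:R =
  \sum_(i < k.+1) \sum_(z in nfaces X i :\: fat i) 'C(k.+2, i.+2)%:R *
     (2 * \sum_(e in fat_edges z) w (e :|: z)).
  transitivity (\sum_(y in nfaces X k.+2) \sum_(i < k.+1)
     \sum_(z in nfaces X i :\: fat i)
     \sum_(e in fat_edges z | e :|: z \subset y) 2 * w y).
    apply: eq_bigr => y _; rewrite natr_sum big_distrr /=; apply: eq_bigr => i _.
    rewrite natr_sum big_distrr /=; apply: eq_bigr => z _.
    by rewrite natr_sum big_distrr /=; apply: eq_bigr => e _; rewrite mulrC.
  rewrite exchange_big /=; apply: eq_bigr => i _.
  rewrite exchange_big /=; apply: eq_bigr => z; rewrite !inE => /andP[_ /andP[zX /eqP cz]].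
  rewrite (exchange_big_dep (mem (fat_edges z))) /=; last by move=> y e _ /andP[].
  rewrite !big_distrr /=; apply: eq_bigr => e ef.
  move/(subsetP (fat_edges_nfaces z)): (ef); rewrite inE linkE.
  move=> /andP[/andP[dez ezX] /eqP ce].
  have cez : #|e :|: z| = i.+2 by rewrite card_disjointU // ce cz.
  have le : (i.+2 <= k.+2)%N by rewrite !ltnS -ltnS.
  rewrite mulrCA -cez -weight_upward // ?cez // big_distrr /=.
  by apply: eq_bigl => y; rewrite ef.
rewrite big_mkord big_distrr /=; apply: ler_sum => i _.
have ik : (i <= k)%N by rewrite -ltnS.
(* The factor i + 2 from [weight_fat_edges] is enlarged to k + 2, which does not depend on i. *)
apply: (@le_trans _ _ (\sum_(z in nfaces X i :\: fat i) 'C(k.+2, i.+2)%:R *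
     (k.+2%:R * (a i + H i) * weight_above (fat i.+1) z))).
  apply: ler_sum => z; rewrite inE => /andP[nf zi].
  apply: ler_wpM2l => //; apply: le_trans (weight_fat_edges ik zi nf) _.
  rewrite -!mulrA ler_wpM2r ?ler_nat //.
  rewrite mulr_ge0 ?addr_ge0 ?a_ge0 ?(ltW (H_gt0 _)) //.
  by apply: sumr_ge0 => s _; apply: weight_ge0.
rewrite -!big_distrr /= [X in _ <= X]mulrC -!mulrA ler_wpM2l //.
have := sum_weight_above (fat_nfaces (ik : (i.+1 <= k.+1)%N)) (subsetDl (nfaces X i) (fat i)).
have c0 : 0 <= k.+2%:R * (a i + H i).
  by apply: mulr_ge0 => //; apply: addr_ge0; [exact: a_ge0 | exact/ltW/H_gt0].
move/(ler_wpM2l c0); rewrite -!mulrA => /le_trans; apply.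
by rewrite le_eqVlt; apply/orP; left; apply/eqP; ring.
Qed.

(* D z stands for the support of d f_z, and Y for that of d f. *)
Lemma weight_descent (c : R) (Y : {set {set V}}) (D : {set V} -> {set {set V}}) :
  0 <= c ->
  (forall z, fatp z -> D z \subset nfaces X k.+2) ->
  (forall y z, fatp z -> y \in D z -> z \in terminals fatp y) ->
  (forall y z, fatp z -> y \in D z -> terminals fatp y = [set z] -> y \in Y) ->
  (forall z, fatp z -> c * W [set x in S | z \in terminals fatp x] <= W (D z)) ->
  c * W S <= W Y + k.+2%:R * \sum_(0 <= i < k.+1)
     'C(k.+2, i.+2)%:R * i.+1%:R * ((a i + H i) * W (fat i.+1)).
Proof.
move=> c0 DX Dterm DY Dw.
(* Members of S are fat, so each has a terminal and is counted for at least one z. *)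
have SE : c * W S <= \sum_(z | fatp z) W (D z).
  apply: (@le_trans _ _ (\sum_(z | fatp z) c * W [set x in S | z \in terminals fatp x]));
    last by apply: ler_sum => z fz; apply: Dw.
  rewrite -big_distrr /=; apply: ler_wpM2l => //.
  have -> : \sum_(z | fatp z) W [set x in S | z \in terminals fatp x] =
     \sum_(z | fatp z) \sum_(x in S | z \in terminals fatp x) w x.
    by apply: eq_bigr => z _; apply: eq_bigl => x; rewrite inE.
  rewrite (exchange_big_dep (mem S)) /=; last by move=> ? ? _ /andP[].
  apply: ler_sum => x xS.
  have fx : fatp x.
    by have := subsetP SX _ xS; rewrite inE /fatp => /andP[_ /eqP ->]; rewrite fat_top.
  have [z zx] := terminals_neq0 fx.
  rewrite (bigD1 z) /= ?xS ?zx ?(terminals_fat zx) // lerDl.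
  by apply: sumr_ge0 => ? _; apply: weight_ge0.
apply: le_trans SE _; apply: le_trans (lerD (lexx _) sum_nbad).
(* With the sums interchanged, it is enough to bound, for each y, the number of z with y in [D z] by
   [nbad y], plus 1 when y is in Y. *)
have -> : \sum_(z | fatp z) W (D z) =
   \sum_(y in nfaces X k.+2) \sum_(z | fatp z && (y \in D z)) w y.
  rewrite /weight_set (exchange_big_dep (mem (nfaces X k.+2))) //=.
  by move=> z y fz; apply: (subsetP (DX z fz)).
have YE : \sum_(y in nfaces X k.+2) w y * (y \in Y)%:R <= W Y.
  rewrite [X in X <= _](bigID (mem Y)) /= [X in _ + X]big1 ?addr0; last first.
    by move=> y /andP[_ /negbTE ->]; rewrite mulr0.
  apply: (@le_trans _ _ (W [set y in nfaces X k.+2 | y \in Y])).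
    rewrite /weight_set [X in _ <= X](eq_bigl (fun y => (y \in nfaces X k.+2) && (y \in Y)));
      last by move=> y; rewrite inE.
    by apply: ler_sum => y /andP[_ ->]; rewrite mulr1.
  by apply: weight_set_sub; apply/subsetP=> y; rewrite inE => /andP[].
apply: le_trans (lerD YE (lexx _)); rewrite -big_split /=.
apply: ler_sum => y yX; rewrite -mulrDr sumr_const -[X in X <= _]mulr_natr.
apply: ler_wpM2l; first exact: weight_ge0.
rewrite -natrD ler_nat.
have sub : [set z | fatp z && (y \in D z)] \subset terminals fatp y.
  by apply/subsetP=> z; rewrite inE => /andP[]; apply: Dterm.
have := subset_leq_card sub; rewrite cardsE => le.
have yX' : y \in X by move: yX; rewrite inE => /andP[].
(* Several terminals are absorbed by [nbad]; otherwise any z with y in [D z] is the only terminal,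
   and y lies in Y. *)
have [gt1|le1] := ltnP 1 #|terminals fatp y|.
  by rewrite (leq_trans le) // (leq_trans (card_terminals yX' gt1)) // leq_addl.
have [e0|] := posnP #|[pred z | fatp z && (y \in D z)]|; first by rewrite e0.
move=> /card_gt0P[z]; rewrite inE => /andP[fz yD].
have tE : terminals fatp y = [set z].
  apply/esym/eqP; rewrite eqEcard sub1set Dterm // cards1 //.
by rewrite (DY y z) // (leq_trans le) // (leq_trans le1) // leq_addr.
Qed.

End Fat.

(** * Ordered faces and cochains *)

Section Orderings.
Variable V : finType.

Lemma tnth_permute n (p : 'S_n) (s : n.-tuple V) i :
  tnth (permute p s) i = tnth s (p i).
Proof. exact: tnth_mktuple. Qed.

Lemma tnth_omit n (i : 'I_n.+1) (s : n.+1.-tuple V) j :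
  tnth (omit i s) j = tnth s (lift i j).
Proof. exact: tnth_mktuple. Qed.

Lemma permuteM n (p q : 'S_n) (s : n.-tuple V) :
  permute q (permute p s) = permute (q * p)%g s.
Proof. by apply: eq_from_tnth => i; rewrite !tnth_permute permM. Qed.

Lemma permute1 n (s : n.-tuple V) : permute 1%g s = s.
Proof. by apply: eq_from_tnth => i; rewrite !tnth_permute perm1. Qed.

Lemma permute_inj n (s : n.-tuple V) : uniq s -> injective (fun p => permute p s).
Proof.
move=> /tuple_uniqP s_inj p q e; apply/permP => i; apply: s_inj.
by rewrite -!tnth_permute e.
Qed.

Lemma orders_permuteP n (s t : n.-tuple V) x :
  orders s x -> orders t x -> exists p, t = permute p s.
Proof.
move=> /andP[us /eqP sx] /andP[ut /eqP tx].
have /tuple_permP[p e] : perm_eq t s.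
  by apply: uniq_perm => // v; have /setP/(_ v) := sx; rewrite -tx !inE => ->.
by exists p; apply: val_inj; exact: e.
Qed.

Lemma orders_card n (s : n.-tuple V) x : orders s x -> #|x| = n.
Proof.
move=> /andP[us /eqP <-]; rewrite cardsE.
by have /card_uniqP -> := us; rewrite size_tuple.
Qed.

Lemma orders_exists n (x : {set V}) : #|x| = n -> exists s : n.-tuple V, orders s x.
Proof.
move=> cx; have sz : size (enum x) == n by rewrite -cardE cx.
exists (Tuple sz); rewrite /orders /= enum_uniq /=.
by apply/eqP/setP=> v; rewrite inE mem_enum.
Qed.

Lemma orders_omit n (i : 'I_n.+1) (s : n.+1.-tuple V) x :
  orders s x -> orders (omit i s) (x :\ tnth s i).
Proof.
move=> /andP[/tuple_uniqP s_inj /eqP sx]; apply/andP; split.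
  by apply/tuple_uniqP=> j1 j2; rewrite !tnth_omit => /s_inj/lift_inj.
apply/eqP/setP=> v; rewrite !inE -sx inE; apply/tnthP/andP.
  case=> j ->; rewrite tnth_omit mem_tnth; split=> //.
  by rewrite (inj_eq s_inj) eq_sym neq_lift.
case=> nv /tnthP[j vj]; move: nv; rewrite vj (inj_eq s_inj) eq_sym => nj.
by have [j' -> _] := unlift_some nj; exists j'; rewrite tnth_omit.
Qed.

Lemma val_omit n (i : 'I_n.+1) (s : n.+1.-tuple V) :
  tval (omit i s) = take i s ++ drop i.+1 s.
Proof.
have szt : size (take i s) = i by rewrite size_takel // size_tuple ltnW.
apply: (@eq_from_nth _ (tnth s i)) => [|j].
  by rewrite size_tuple size_cat szt size_drop size_tuple; have := ltn_ord i; lia.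
rewrite size_tuple => jn.
have -> : nth (tnth s i) (tval (omit i s)) j = tnth (omit i s) (Ordinal jn).
  by rewrite [RHS](tnth_nth (tnth s i)).
rewrite tnth_omit [LHS](tnth_nth (tnth s i)) /= nth_cat szt /bump.
by have [ji|ij] := ltnP j i; rewrite ?nth_take // nth_drop add1n addSn subnKC.
Qed.

Lemma lift_perm_exists n (p : 'S_n.+1) (i : 'I_n.+1) :
  exists q : 'S_n, p = lift_perm i (p i) q.
Proof.
have ne j : p i != p (lift i j) by rewrite (inj_eq perm_inj) neq_lift.
have inj : injective (fun j => odflt j (unlift (p i) (p (lift i j)))).
  move=> j1 j2; have [j1' e1 ->] := unlift_some (ne j1).
  have [j2' e2 ->] /= := unlift_some (ne j2) => e.
  by move: e1; rewrite e -e2 => /perm_inj/lift_inj.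
exists (perm inj); apply/permP=> j; case: (unliftP i j) => [j'|] ->.
  by rewrite lift_perm_lift permE; have [j'' e1 e2] := unlift_some (ne j'); rewrite e2 e1.
by rewrite lift_perm_id.
Qed.

(** Since p is a lift of some q, both the action on the remaining positions and the parity can be
    read off. This is what makes coboundaries alternating. *)
Lemma omit_permute n (p : 'S_n.+1) (i : 'I_n.+1) : exists q : 'S_n,
  (forall s : n.+1.-tuple V, omit i (permute p s) = permute q (omit (p i) s)) /\
  odd_perm p = odd i (+) odd (p i) (+) odd_perm q.
Proof.
have [q e] := lift_perm_exists p i; exists q; split=> [s|].
  apply: eq_from_tnth => j; rewrite tnth_omit !tnth_permute tnth_omit.
  by rewrite {1}e lift_perm_lift.
by rewrite {1}e odd_lift_perm.
Qed.

(** The extension by the identity is built one transposition at a time, which keeps the parity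
    visible. *)
Lemma perm_widen m n (le : (m <= n)%N) (q : 'S_m) : exists p : 'S_n,
  [/\ forall j, p (widen_ord le j) = widen_ord le (q j),
      forall j : 'I_n, (m <= j)%N -> p j = j & odd_perm p = odd_perm q].
Proof.
have [ts -> _] := prod_tpermP q.
elim: ts => [|[a b] ts [p [p1 p2 po]]].
  by exists 1%g; rewrite !big_nil !odd_perm1; split=> [j|j _|]; rewrite ?perm1.
exists (tperm (widen_ord le a) (widen_ord le b) * p)%g.
have inj : injective (widen_ord le) by move=> j1 j2 [] /val_inj.
rewrite big_cons !odd_permM !odd_tperm (inj_eq inj) po; split=> // j.
  by rewrite !permM -(inj_tperm _ _ _ inj) p1.
move=> mj; rewrite permM tpermD ?p2 //; apply/eqP=> e; move: mj;
  by rewrite -e leqNgt /= ltn_ord.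
Qed.

(** The length is a separate n with an equation, since the cochains evaluated on it are indexed by k
    + 1 and the like rather than by a sum. *)
Definition catt m p n (e : (m + p = n)%N) (t : m.-tuple V) (z : p.-tuple V) :
  n.-tuple V := tcast e [tuple of t ++ z].

Lemma val_catt m p n (e : (m + p = n)%N) (t : m.-tuple V) (z : p.-tuple V) :
  tval (catt e t z) = t ++ z.
Proof. by rewrite /catt val_tcast. Qed.

Lemma catt_permute m p n (e : (m + p = n)%N) (q : 'S_m) : exists r : 'S_n,
  (forall t z, catt e (permute q t) z = permute r (catt e t z)) /\
  odd_perm r = odd_perm q.
Proof.
have le : (m <= n)%N by rewrite -e leq_addr.
have [r [r1 r2 ro]] := perm_widen le q; exists r; split=> // t z.
apply: eq_from_tnth => i; rewrite tnth_permute.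
case: (ltnP i m) => im.
  have iE : i = widen_ord le (Ordinal im) by apply: val_inj.
  rewrite {2}iE r1; set x0 := tnth t (Ordinal im).
  rewrite !(tnth_nth x0) !val_catt !nth_cat !size_tuple im /= ltn_ord.
  by have := tnth_permute q t (Ordinal im); rewrite !(tnth_nth x0).
rewrite r2 //; have iz : (i - m < p)%N by rewrite ltn_subLR // e.
set x0 := tnth z (Ordinal iz); rewrite !(tnth_nth x0) !val_catt !nth_cat !size_tuple.
by rewrite ltnNge im.
Qed.

Lemma orders_catt m p n (e : (m + p = n)%N) (t : m.-tuple V) (z : p.-tuple V)
    (x : {set V}) :
  uniq z -> [disjoint x & [set v in z]] -> orders t x ->
  orders (catt e t z) (x :|: [set v in z]).
Proof.
move=> uz dxz /andP[ut /eqP tx]; rewrite /orders val_catt cat_uniq ut uz andbT /=.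
apply/andP; split.
  apply/hasPn=> v vz; apply: contraL dxz => vt; apply/negP=> /disjoint_setI0/setP/(_ v).
  by rewrite -tx !inE vz (vt : v \in t).
by apply/eqP/setP=> v; rewrite -tx !inE -mem_cat -(val_catt e).
Qed.

End Orderings.

(** * Supports and coboundaries of alternating families *)

Lemma mulrz_sign_eq0 (A : zmodType) (a : A) (b : bool) :
  (a *~ (-1) ^+ b == 0) = (a == 0).
Proof. by case: b; rewrite ?expr0 ?expr1 ?mulr1z // mulrN1z oppr_eq0. Qed.

Section Families.
Variables (V : finType) (X : {set {set V}}) (F : sheaf_data V).
Hypothesis X_down : forall x y : {set V}, y \in X -> x \subset y -> x \in X.

Lemma cochain_neq0 n (f : face_family F n) x (s t : n.-tuple V) :
  is_cochain X f -> x \in X -> orders s x -> orders t x -> f x s != 0 -> f x t != 0.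
Proof.
move=> cf xX sx tx; have [p ->] := orders_permuteP sx tx.
by rewrite cf // mulrz_sign_eq0.
Qed.

Lemma supp_card n (f : face_family F n) : supp X f \subset nfaces X n.
Proof.
apply/subsetP=> x; rewrite !inE => /andP[-> /existsP[s /andP[sx _]]] /=.
by rewrite (orders_card sx).
Qed.

Lemma suppP n (f : face_family F n) x (s : n.-tuple V) : is_cochain X f ->
  x \in X -> orders s x -> (x \in supp X f) = (f x s != 0).
Proof.
move=> cf xX sx; rewrite inE xX /=; apply/existsP/idP.
  by case=> t /andP[tx]; apply: cochain_neq0.
by exists s; rewrite sx.
Qed.

Lemma delta_cochain n (f : face_family F n) : is_cochain X f -> is_cochain X (delta f).
Proof.
(* Reindexing by p matches omission at i on one side with omission at p i on the other. *)
move=> cf x s p xX sx; rewrite /delta mulrz_suml [RHS](reindex_inj (@perm_inj _ p)) /=.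
apply: eq_bigr => i _; have [q [eq_q odd_q]] := omit_permute V p i.
rewrite tnth_permute eq_q cf; last first.
- exact: orders_omit.
- by apply: X_down xX _; rewrite subsetDl.
rewrite raddfMz -!mulrzA odd_q; congr (_ *~ _); move: (odd_perm q) => b.
rewrite -[(-1) ^+ i]signr_odd -[(-1) ^+ (p i)]signr_odd !signr_addb.
by move: b (odd i) (odd (p i)) => [] [] [].
Qed.

Lemma add_cochain n (f g : face_family F n) :
  is_cochain X f -> is_cochain X g -> is_cochain X (add_family f g).
Proof. by move=> cf cg x s p xX sx; rewrite /add_family cf // cg // mulrzDl. Qed.

Lemma eq_supp n (f g : face_family F n) : eq_cochain X f g -> supp X f = supp X g.
Proof.
move=> fg; apply/setP=> x; rewrite !inE; have [xX|//] := boolP (x \in X).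
by apply: eq_existsb => s; have [sx|//] := boolP (orders s x); rewrite fg.
Qed.

End Families.

(** * Cochains on links *)

(** Values of the link sheaf live over y :\: z :|: z, which equals y only propositionally. The
    transport is made total by the value 0 when the faces differ. *)
Definition cast_stalk (V : finType) (F : sheaf_data V) (x y : {set V}) (a : F x) : F y :=
  if eqP is ReflectT e then eq_rect x (fun t => F t) a y e else (0 : F y).

Lemma cast_stalk_id (V : finType) (F : sheaf_data V) (x : {set V}) (a : F x) :
  cast_stalk x a = a.
Proof. by rewrite /cast_stalk; case: eqP => // e; rewrite eq_axiomK. Qed.

Lemma cast_stalkMz (V : finType) (F : sheaf_data V) (x y : {set V}) (a : F x) n :
  cast_stalk y (a *~ n) = cast_stalk y a *~ n.
Proof.
by rewrite /cast_stalk; case: eqP => [e|]; [case: y / e | rewrite mul0rz].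
Qed.

Section LinkFamilies.
Variables (V : finType) (X : {set {set V}}) (F : sheaf_data V).
Hypothesis X_down : forall x y : {set V}, y \in X -> x \subset y -> x \in X.
Variables (p : nat) (z : p.-tuple V).
Hypothesis z_uniq : uniq z.
Local Notation zs := [set v in z].
Local Notation Fz := (link_sheaf F zs).
Local Notation Xz := (link X zs).

Lemma link_down (x y : {set V}) : y \in Xz -> x \subset y -> x \in Xz.
Proof.
rewrite !linkE => /andP[dy yX] xy; rewrite (disjointWl xy dy) /=.
by apply: X_down yX _; apply: setSU.
Qed.

(** With P selecting the faces that have z as a terminal, this is f_z. Placing z after t agrees with
    [is_extension] and spares a sign in [delta_link]. *)
Definition restrict_link m n (e : (m + p = n)%N) (P : pred {set V})
    (f : face_family F n) : face_family Fz m :=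
  fun x t => if P (x :|: zs) then f (x :|: zs) (catt e t z) else 0.

Lemma restrict_link_cochain m n (e : (m + p = n)%N) P (f : face_family F n) :
  is_cochain X f -> is_cochain Xz (restrict_link e P f).
Proof.
move=> cf x t q; rewrite linkE => /andP[dxz xX] tx.
rewrite /restrict_link; case: ifP => _; last by rewrite mul0rz.
have [r [-> <-]] := catt_permute V e q.
by apply: cf => //; apply: orders_catt.
Qed.

Lemma lift_supp_restrict m n (e : (m + p = n)%N) P (f : face_family F n) :
  is_cochain X f ->
  lift_faces X zs (supp Xz (restrict_link e P f))
    = [set x in supp X f | (zs \subset x) && P x].
Proof.
move=> cf; apply/setP=> y.
have -> : (y \in [set x in supp X f | (zs \subset x) && P x])
  = [&& y \in supp X f, zs \subset y & P y] by rewrite in_set.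
rewrite in_set; have [yX|nX] := boolP (y \in X); last first.
  by rewrite [in RHS]/supp [y \in [set _ in X | _]]in_set (negbTE nX).
have [zy|] := boolP (zs \subset y); last by rewrite /= ?andbF.
have dyz : [disjoint y :\: zs & zs] := disjointDl y zs.
have yl : y :\: zs \in Xz by rewrite linkE dyz setDKU.
rewrite /=; apply/idP/andP.
  rewrite inE yl /= => /existsP[t /andP[tx]]; rewrite /restrict_link.
  have := orders_catt e z_uniq dyz tx; rewrite setDKU // => oc.
  by case: ifP => [Py|_]; rewrite ?eqxx // (suppP cf yX oc).
case=> ys Py; have /orders_exists[t tx] : #|y :\: zs| = m.
  have /subsetP/(_ _ ys) := supp_card X f; rewrite inE cardsDS // => /andP[_ /eqP ->].
  by rewrite cardsE (card_uniqP z_uniq) size_tuple -e addnK.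
have := orders_catt e z_uniq dyz tx; rewrite setDKU // => oc.
rewrite inE yl /=; apply/existsP; exists t; rewrite tx /= /restrict_link.
by rewrite setDKU // Py -(suppP cf yX oc).
Qed.

(** Omitting a vertex of z contributes 0 by the last hypothesis; since z comes last, the other
    omissions carry the same signs on both sides. *)
Lemma delta_link m n (e : (m + p = n)%N) (e' : (m.+1 + p = n.+1)%N)
    (f : face_family F n) (g : face_family Fz m) (x : {set V}) (t : m.+1.-tuple V) :
  [disjoint x & zs] -> orders t x ->
  (forall i, f ((x :\ tnth t i) :|: zs) (catt e (omit i t) z)
               = g (x :\ tnth t i) (omit i t)) ->
  (forall v s, v \in zs -> orders s ((x :|: zs) :\ v) -> f ((x :|: zs) :\ v) s = 0) ->
  delta f (x :|: zs) (catt e' t z) = delta g x t.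
Proof.
move=> dxz tx fg f0; subst n; have oc := orders_catt e' z_uniq dxz tx.
rewrite /delta (@big_split_ord _ _ _ m.+1 p) /= [X in _ + X]big1 ?addr0; last first.
  move=> i _; set j := rshift _ i.
  have tj : tnth (catt e' t z) j \in zs.
    rewrite inE [tnth _ _](tnth_nth (tnth z i)) val_catt nth_cat size_tuple /= ltnNge leq_addr /=.
    by rewrite addKn mem_nth // size_tuple.
  by rewrite (f0 _ _ tj) ?raddf0 ?mul0rz //; apply: orders_omit.
apply: eq_bigr => i _; set j := lshift _ i.
have -> : tnth (catt e' t z) j = tnth t i.
  rewrite [LHS](tnth_nth (tnth t i)) val_catt nth_cat size_tuple /= ltn_ord.
  exact/esym/tnth_nth.
have -> : omit j (catt e' t z) = catt (erefl (m + p)%N) (omit i t) z.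
  apply: val_inj; rewrite /= val_omit !val_catt ?val_omit /=.
  rewrite take_cat drop_cat size_tuple ltn_ord -catA; congr (_ ++ _).
  have [//|mi] := ltnP i.+1 m.+1.
  by rewrite (drop_oversize (s := t)) ?size_tuple //= (_ : (i.+1 - m.+1 = 0)%N) ?drop0 //;
     have := ltn_ord i; move: mi; clear; lia.
have -> : (x :|: zs) :\ tnth t i = (x :\ tnth t i) :|: zs.
  rewrite setDUl; congr (_ :|: _); apply/setDidPl; rewrite disjoint_sym disjoints1.
  have ix : tnth t i \in x by case/andP: tx => _ /eqP <-; rewrite inE mem_tnth.
  apply/negP=> iz; have /disjoint_setI0/setP/(_ (tnth t i)) := dxz.
  by rewrite in_setI ix iz inE.
by rewrite fg.
Qed.

Lemma extension_exists m n (e : (m + p = n)%N) (g : face_family Fz m) :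
  is_cochain Xz g -> exists G : face_family F n, is_extension X g G.
Proof.
move=> cg.
(* G writes s as a reordering of t followed by z and takes g at t with the sign of that
   reordering. *)
pose Q (y : {set V}) (s : n.-tuple V) (tq : m.-tuple V * 'S_n) :=
  [&& zs \subset y, orders tq.1 (y :\: zs) & s == permute tq.2 (catt e tq.1 z)].
pose G : face_family F n := fun y s =>
  if [pick tq | Q y s tq] is Some tq
  then @cast_stalk V F (y :\: zs :|: zs) y (g (y :\: zs) tq.1 *~ (-1) ^+ odd_perm tq.2) else 0.
have dDz (y : {set V}) : [disjoint y :\: zs & zs] := disjointDl y zs.
(* The choice of t and q is immaterial: another t is a reordering of this one, and the change of
   sign of g cancels that of q. *)
have GE (y : {set V}) t q : y \in X -> zs \subset y -> orders t (y :\: zs) ->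
    G y (permute q (catt e t z))
      = @cast_stalk V F (y :\: zs :|: zs) y (g (y :\: zs) t *~ (-1) ^+ odd_perm q).
  move=> yX zy ty; rewrite /G; case: pickP => [[t' q'] /and3P[/= _ ty' /eqP eq_q]|]; last first.
    by move/(_ (t, q)); rewrite /Q /= zy ty eqxx.
  have [r tr] := orders_permuteP ty ty'; have [r' [er or]] := catt_permute V e r.
  congr (cast_stalk _ _); rewrite tr cg ?linkE ?dDz ?setDKU // -mulrzA; congr (_ *~ _).
  move: eq_q; rewrite tr er permuteM => /(@permute_inj _ _ _ _) -> //.
    rewrite odd_permM or; move: (odd_perm r) (odd_perm q').
    by move=> [] [].
  by have /andP[] := orders_catt e z_uniq (dDz y) ty.
exists G; split.
- move=> y s q yX sy; have [zy|nzy] := boolP (zs \subset y); last first.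
    have G0 s' : G y s' = 0 by rewrite /G; case: pickP => // tq /and3P[]; rewrite (negbTE nzy).
    by rewrite !G0 mul0rz.
  have /orders_exists[t ty] : #|y :\: zs| = m.
    by rewrite cardsDS // (orders_card sy) cardsE (card_uniqP z_uniq) size_tuple -e addnK.
  have oc := orders_catt e z_uniq (dDz y) ty; rewrite setDKU // in oc.
  have [r ->] := orders_permuteP oc sy.
  rewrite permuteM !GE // -cast_stalkMz -mulrzA; congr (cast_stalk _ (_ *~ _)).
  by rewrite odd_permM; move: (odd_perm q) (odd_perm r) => [] [].
- move=> x t s; rewrite linkE => /andP[dxz xX] tx st.
  have -> : s = permute 1 (catt e t z).
    by rewrite permute1; apply: val_inj; rewrite /= val_catt.
  rewrite GE ?subsetUr ?setUDK // odd_perm1 expr0 mulr1z.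
  exact: (@cast_stalk_id _ F).
- move=> y s _ _ nzy; rewrite /G; case: pickP => // tq /and3P[].
  by rewrite (negbTE nzy).
Qed.

End LinkFamilies.

(** * Expansion at a single face *)

Lemma link_decomp (V : finType) (X : {set {set V}}) (z y : {set V}) :
  y \in X -> z \subset y ->
  exists x, [/\ y = x :|: z, [disjoint x & z] & x \in link X z].
Proof.
by move=> yX zy; exists (y :\: z); rewrite linkE disjointDl setDKU.
Qed.

Section LocalExpansion.
Variables (R : realType) (V : finType) (d : nat) (X : {set {set V}}).
Variable F : sheaf_data V.
Hypothesis Xd : is_dcomplex d X.
Local Notation w := (weight R d X).
Local Notation W := (weight_set R d X).

Lemma weight_set_ID (S O : {set {set V}}) : W S = W (S :&: O) + W (S :\: O).
Proof. exact: big_setID. Qed.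

Lemma weight_link_total n (z : {set V}) : z \in X -> (#|z| <= d)%N ->
  (n + #|z| <= d.+1)%N ->
  weight_set R (d - #|z|) (link X z) (nfaces (link X z) n) = 1.
Proof.
move=> zX zd nd; have w0 := weight_gt0 R Xd zX.
have c0 : 0 < 'C(n + #|z|, #|z|)%:R * w z.
  by rewrite mulr_gt0 // ltr0n bin_gt0 leq_addl.
apply: (mulfI (lt0r_neq0 c0)); rewrite mulr1 -weight_lift_faces //.
rewrite -weight_upward ?leq_addl //; apply: eq_bigl => y; rewrite inE.
have [yX|nX] := boolP (y \in X); last by rewrite [y \in nfaces _ _]in_set (negbTE nX).
have [zy|_] := boolP (z \subset y); last by rewrite andbF.
have [x [-> dxz xl]] := link_decomp yX zy.
rewrite setUDK // !inE xl card_disjointU // eqn_add2r andbT.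
by move: xl; rewrite linkE => /andP[_ ->].
Qed.

Section AtFace.
Variables (k i m : nat) (z : i.+1.-tuple V) (f : face_family F k.+1).
Local Notation zs := [set v in z].
Local Notation Fz := (link_sheaf F zs).
Local Notation Xz := (link X zs).
Hypothesis z_uniq : uniq z.
Hypothesis zX : zs \in X.
Hypothesis f_cochain : is_cochain X f.
Hypothesis f_min : locally_minimal R d X f.
Variable e : (m + i.+1 = k.+1)%N.

Let Xdown := face_subset Xd.

Lemma card_zs : #|zs| = i.+1.
Proof. by rewrite cardsE (card_uniqP z_uniq) size_tuple. Qed.

(** If b is the coboundary of g, then d(g^z) agrees with b above z and vanishes on the other faces.
    So local minimality compares f with f + d(g^z), and only the part of the norm above z
    changes. *)
Lemma restrict_link_minimal (b : face_family Fz m) : is_coboundary Xz b ->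
  W (lift_faces X zs (supp Xz (restrict_link z e predT f)))
    <= W (lift_faces X zs (supp Xz (add_family (restrict_link z e predT f) b))).
Proof.
(* When m = 0, the face z has dimension k and the only coboundary on its link in this degree is
   0. *)
case: m e b => [|m'] e' b /=.
  move=> b0; rewrite (_ : supp _ (add_family _ _) = supp Xz (restrict_link z e' predT f)) //.
  by apply: eq_supp => x t xX tx; rewrite /add_family b0 // addr0.
case=> g cg eb.
have em : m' = (k - i.+1)%N by move: e'; clear; lia.
subst m'; have ik : (i < k)%N by move: e'; clear; lia.
have e1 : (k - i.+1 + i.+1 = k)%N by rewrite subnK.
have [G extG] := extension_exists z_uniq e1 cg.
have := f_min ik z_uniq zX cg extG; rewrite /cnorm.
case: extG => cG Gz G0.
have cfG : is_cochain X (add_family f (delta G)).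
  by apply: add_cochain => //; apply: delta_cochain.
(* Off O the two supports agree, so their contributions cancel. *)
pose O := [set y : {set V} | zs \subset y].
rewrite (weight_set_ID (supp X f) O) (weight_set_ID (supp X (add_family _ _)) O).
have -> : supp X (add_family f (delta G)) :\: O = supp X f :\: O.
  apply/setP=> y; rewrite !in_setD; have [//|nzy] := boolP (y \in O).
  rewrite /= ![y \in supp _ _]inE; have [yX|//] := boolP (y \in X).
  apply: eq_existsb => s; have [sy|//] := boolP (orders s y).
  congr (_ && (_ != 0)); rewrite /add_family /delta big1 ?addr0 // => j _.
  rewrite G0 ?raddf0 ?mul0rz //; first by apply: Xdown yX _; rewrite subsetDl.
    exact: orders_omit.
  move: nzy; rewrite inE; apply: contra => /subset_trans; apply; exact: subsetDl.
rewrite lerD2r lift_supp_restrict //.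
have -> : [set x in supp X f | (zs \subset x) && predT x] = supp X f :&: O.
  by apply/setP=> x; rewrite in_set in_setI [x \in O]in_set andbT.
move/le_trans; apply; apply: weight_set_sub; apply/subsetP=> y.
rewrite in_setI [y \in O]in_set => /andP[ys zy].
have /subsetP/(_ _ ys) := supp_card X (add_family f (delta G)).
rewrite inE => /andP[yX /eqP cy].
have [x [yE dxz xl]] := link_decomp yX zy; subst y.
rewrite inE yX zy setUDK //= inE xl /=; apply/existsP.
have /orders_exists[t tx] : #|x| = (k - i.+1).+1.
  by move: cy e'; rewrite card_disjointU // card_zs; clear; lia.
exists t; rewrite tx /= /add_family eb //.
rewrite -(@delta_link _ _ _ _ z_uniq _ _ e1 e' G) //.
- by rewrite -(suppP cfG yX (orders_catt e' z_uniq dxz tx)).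
- move=> j; apply: Gz => //; last by rewrite val_catt.
    by apply: link_down xl _; rewrite ?subsetDl.
  exact: orders_omit.
- move=> v s vz sy; apply: G0 => //.
    by apply: Xdown yX _; rewrite subsetDl.
  by apply/negP=> /subsetP/(_ v vz); rewrite !inE eqxx.
Qed.

(* Shrinking the support of a cochain of minimal norm in its coboundary class
   leaves it minimal. *)
Lemma restrict_link_minimal_pred P (b : face_family Fz m) : is_coboundary Xz b ->
  W (lift_faces X zs (supp Xz (restrict_link z e P f)))
    <= W (lift_faces X zs (supp Xz (add_family (restrict_link z e P f) b))).
Proof.
move=> cb; have := restrict_link_minimal cb.
set A := lift_faces _ _ (supp _ (restrict_link _ _ predT _)).
set A' := lift_faces _ _ (supp _ (add_family (restrict_link _ _ predT _) _)).
set B := lift_faces _ _ (supp _ (restrict_link _ _ P _)).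
set B' := lift_faces _ _ (supp _ (add_family (restrict_link _ _ P _) _)).
have BA : B \subset A.
  rewrite /A /B !lift_supp_restrict //; apply/subsetP=> x.
  by rewrite !in_set => /and3P[-> -> _].
(* Where P fails the restricted cochain is 0, so adding b to it or to the full cochain gives
   different values only on A :\: B. Hence W A <= W A' <= W B' + W (A :\: B), and W (A :\: B) is
   subtracted from both ends. *)
have sub : A' \subset B' :|: A :\: B.
  apply/subsetP=> y; rewrite in_set => /and3P[yX zy].
  have [x [yE dxz xl]] := link_decomp yX zy; subst y.
  rewrite setUDK // inE => /andP[_ /existsP[t /andP[tx ne]]].
  have oc := orders_catt e z_uniq dxz tx.
  have inB' : add_family (restrict_link z e P f) b x t != 0 -> x :|: zs \in B'.
    move=> neB; rewrite in_set yX subsetUr setUDK //= inE xl /=.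
    by apply/existsP; exists t; rewrite tx.
  rewrite in_setU in_setD; have [Px|nPx] := boolP (P (x :|: zs)).
    by rewrite inB' //; move: ne; rewrite /add_family /restrict_link Px.
  have -> : x :|: zs \notin B.
    by rewrite /B lift_supp_restrict // in_set (negbTE nPx) !andbF.
  have [_|nA] := boolP (x :|: zs \in A); first by rewrite orbT.
  rewrite inB' //; move: ne; rewrite /add_family /restrict_link (negbTE nPx) /=.
  move: nA; rewrite /A lift_supp_restrict // in_set zy !andbT (suppP f_cochain yX oc).
  by rewrite negbK => /eqP ->.
rewrite (weight_set_ID A B) (setIidPr BA) => le.
rewrite -(lerD2r (W (A :\: B))); apply: le_trans le _.
apply: le_trans (weight_set_sub _ _ _ sub) _.
rewrite (weight_set_ID (_ :|: _) B') lerD //.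
  by apply: weight_set_sub; rewrite subsetIr.
by apply: weight_set_sub; rewrite setDUl setDv set0U subsetDl.
Qed.

(** Nontrivial stalks make the mass in degree m + 1 equal to 1, the other mass is at most 1, and
    minimality removes the coboundary b. Passing from the link to X, the identity (k + 2) 'C(k + 1,
    i + 1) = (m + 1) 'C(k + 2, i + 1) produces the factor (k + 2) / (m + 1). *)
Lemma restrict_link_expansion (P : pred {set V}) (eps : R) :
  (k.+1 <= d)%N -> 0 <= eps ->
  coboundary_expander (d - #|zs|) Xz Fz m eps ->
  (forall x, x \in nfaces X k.+2 -> nontrivial (F x)) ->
  k.+2%:R * eps / m.+1%:R * W [set x in supp X f | (zs \subset x) && P x]
    <= W (lift_faces X zs (supp Xz (delta (restrict_link z e P f)))).
Proof.
move=> kd eps0 ce Fnz; rewrite -(lift_supp_restrict z_uniq e P f_cochain).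
have c_zs := card_zs.
have zd : (#|zs| <= d)%N by rewrite c_zs; move: e kd; clear; lia.
have [b [cb _]] := ce _ (restrict_link_cochain z_uniq e P f_cochain).
have -> : mass R (d - #|zs|) Xz Fz m.+1 = 1.
  rewrite /mass faces_subr1 -(@weight_link_total m.+1 _ zX zd); last first.
    by rewrite c_zs addSn e ltnS.
  congr weight_set; apply/setP=> x; rewrite in_set.
  have [xn|//] := boolP (x \in nfaces Xz m.+1); rewrite /=; apply: Fnz.
  move: xn; rewrite !inE linkE => /andP[/andP[dxz ->] /eqP cx] /=.
  by rewrite card_disjointU // cx c_zs addSn e.
have m1 : mass R (d - #|zs|) Xz Fz m <= 1.
  rewrite -(@weight_link_total m _ zX zd); last by rewrite c_zs e ltnW.
  rewrite /mass faces_subr1; apply: weight_set_sub.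
  by apply/subsetP=> x; rewrite in_set => /andP[].
rewrite mulr1 /cnorm => exp1; rewrite c_zs in exp1 m1.
have := restrict_link_minimal_pred P cb.
rewrite !(weight_lift_faces R Xd zd (supp_card _ _)) c_zs e addSn e.
set cn := weight_set R _ _ (supp _ (restrict_link _ _ _ _)).
move: exp1; set cnb := weight_set R _ _ (supp _ (add_family _ _)).
set cnd := weight_set R _ _ (supp _ (delta _)) => exp1.
have w0 := weight_gt0 R Xd zX.
have c1 : 0 < 'C(k.+1, i.+1)%:R * w zs.
  by rewrite mulr_gt0 // ltr0n bin_gt0; move: e; clear; lia.
rewrite ler_pM2l // => min1.
have exp2 : eps * cn <= cnd.
  apply: le_trans (ler_wpM2l eps0 min1) _; apply: le_trans exp1 _.
  rewrite -[X in _ <= X]mulr1; apply: ler_wpM2l => //.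
  by apply: sumr_ge0 => x _; apply: weight_ge0.
have bE : (k.+2 * 'C(k.+1, i.+1) = m.+1 * 'C(k.+2, i.+1))%N.
  by have := mul_bin_down k.+2 i.+1; rewrite /= => ->; congr (_ * _)%N; move: e; clear; lia.
have m0 : m.+1%:R != 0 :> R by rewrite pnatr_eq0.
have -> : k.+2%:R * eps / m.+1%:R * ('C(k.+1, i.+1)%:R * w zs * cn)
  = (k.+2 * 'C(k.+1, i.+1))%:R / m.+1%:R * w zs * (eps * cn) :> R.
  by rewrite natrM; ring.
rewrite bE natrM [m.+1%:R * _]mulrC mulfK //.
by apply: ler_wpM2l => //; apply: mulr_ge0 => //; apply: ltW.
Qed.

End AtFace.

(** D is the lifted support of d f_z. Under the premise of the third clause, f vanishes on every
    facet of y that f_z ignores, so d f and d f_z agree at y. *)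
Lemma local_expansion (k i : nat) (f : face_family F k.+1) (P : pred {set V})
    (z : {set V}) (eps : R) :
  (k.+1 <= d)%N -> (i <= k)%N -> 0 <= eps ->
  is_cochain X f -> locally_minimal R d X f ->
  z \in nfaces X i.+1 ->
  coboundary_expander (d - #|z|) (link X z) (link_sheaf F z) (k - i) eps ->
  (forall x, x \in nfaces X k.+2 -> nontrivial (F x)) ->
  exists D : {set {set V}}, [/\ D \subset nfaces X k.+2,
    forall y, y \in D -> exists x,
      [/\ x \in supp X f, P x, z \subset x, x \subset y & #|y| = #|x|.+1],
    forall y, y \in D ->
      (forall x, x \in supp X f -> x \subset y -> (z \subset x) && P x) ->
      y \in supp X (delta f)
    & k.+2%:R * eps / (k.+1 - i)%:R *
        W [set x in supp X f | (z \subset x) && P x] <= W D].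
Proof.
move=> kd ik eps0 cf lmin; rewrite inE => /andP[zX /eqP cz].
have [zt /andP[uz /eqP zE]] := orders_exists cz; subst z => ce Fnz.
have e : (k - i + i.+1 = k.+1)%N by move: ik; clear; lia.
have e1 : ((k - i).+1 + i.+1 = k.+2)%N by rewrite addSn e.
set zs := [set v in zt]; have c_zs : #|zs| = i.+1 := card_zs uz.
set fz := restrict_link zt e P f.
exists (lift_faces X zs (supp (link X zs) (delta fz))).
have Dinv y : y \in lift_faces X zs (supp (link X zs) (delta fz)) ->
    exists x, exists2 t : (k - i).+1.-tuple V,
      [/\ y = x :|: zs, [disjoint x & zs] & x :|: zs \in X]
      & orders t x /\ delta fz x t != 0.
  rewrite in_set => /and3P[yX zy]; have [x [yE dxz xl]] := link_decomp yX zy; subst y.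
  rewrite setUDK // inE xl /= => /existsP[t /andP[tx ne]].
  by exists x, t.
have omitX x (t : (k - i).+1.-tuple V) j : orders t x -> [disjoint x & zs] ->
    x :|: zs \in X -> [/\ [disjoint x :\ tnth t j & zs], x :\ tnth t j :|: zs \in X
      & x :\ tnth t j :|: zs \subset x :|: zs].
  move=> tx dxz xX; have sub : x :\ tnth t j :|: zs \subset x :|: zs.
    by rewrite setSU // subsetDl.
  split=> //; first by apply: disjointWl dxz; apply: subsetDl.
  exact: (face_subset Xd xX sub).
split.
- apply/subsetP=> y /Dinv[x [t [-> dxz xX] [tx _]]].
  by rewrite inE xX card_disjointU // (orders_card tx) c_zs e1 eqxx.
- move=> y /Dinv[x [t [-> dxz xX] [tx ne]]].
  have [j nej] : exists j, fz (x :\ tnth t j) (omit j t) != 0.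
    apply: contrapT => no; move: ne; rewrite /delta big1 ?eqxx // => j _.
    have [->|nej] := eqVneq (fz (x :\ tnth t j) (omit j t)) 0.
      by rewrite raddf0 mul0rz.
    by case: no; exists j.
  have [dj jX jsub] := omitX x t j tx dxz xX; have tj := orders_omit j tx.
  have oc := orders_catt e uz dj tj.
  exists (x :\ tnth t j :|: zs); move: nej; rewrite /fz /restrict_link.
  case: ifP => [Pj nej|]; last by rewrite eqxx.
  split=> //; [by rewrite (suppP cf jX oc) | exact: subsetUr | ].
  by rewrite !card_disjointU // (orders_card tj) (orders_card tx).
- move=> y /Dinv[x [t [-> dxz xX] [tx ne]]] all_below.
  rewrite inE xX /=; apply/existsP; exists (catt e1 t zt).
  rewrite orders_catt //= (delta_link uz (e := e) e1 (g := fz)) //.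
  + move=> j; have [dj jX jsub] := omitX x t j tx dxz xX.
    have oc := orders_catt e uz dj (orders_omit j tx).
    rewrite /fz /restrict_link; case: ifP => // nP.
    apply/eqP; apply: contraFT nP => nef.
    by have /andP[] := all_below _ (etrans (suppP cf jX oc) nef) jsub.
  + move=> v s vz sy; apply/eqP; apply: contrapT => /negP nef.
    have vX : (x :|: zs) :\ v \in X by apply: (face_subset Xd xX); rewrite subsetDl.
    have /andP[/subsetP/(_ v vz)] := all_below _ (etrans (suppP cf vX sy) nef) (subsetDl _ _).
    by rewrite !inE eqxx.
- have -> : (k.+1 - i = (k - i).+1)%N by rewrite subSn.
  exact: restrict_link_expansion.
Qed.

End LocalExpansion.

(** * The expansion inequality *)

(** Vertices can be added one at a time in any order, as every set above s belongs to E. *)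
Lemma vine_chain n (E : {set {set 'I_n}}) (s : {set 'I_n}) m :
  (forall t : {set 'I_n}, s \subset t -> t \in E) -> (n - #|s| = m)%N ->
  exists c : m.-tuple {set 'I_n},
    path (vine_step E) s c && (last s c == [set: 'I_n]).
Proof.
elim: m s => [|m IH] s sE csm.
  exists [tuple]; rewrite /= eqEcard subsetT cardsT card_ord /=.
  by rewrite -subn_eq0 csm.
have [v vs] : exists v, v \notin s.
  apply: contrapT => no; have sT : s = setT.
    by apply/setP=> v; rewrite inE; apply: contrapT => /negP nv; apply: no; exists v.
  by move: csm; rewrite sT cardsT card_ord subnn.
have [||c /andP[pc lc]] := IH (v |: s).
- by move=> t /subUsetP[_]; apply: sE.
- by rewrite cardsU1 vs add1n subnS csm.
exists [tuple of (v |: s) :: c]; rewrite /= pc lc !andbT /vine_step subsetUr.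
by rewrite sE ?subsetUr // cardsU1 vs add1n /=.
Qed.

(* Witnessed by the vine of all nonempty subsets. *)
Lemma U_ge n : (0 < n)%N -> (n <= U n)%N.
Proof.
move=> n0; pose E := [set s : {set 'I_n} | s != set0].
have vE : vine E.
  apply/andP; split.
    by rewrite inE -card_gt0 cardsT card_ord.
  apply/forall_inP=> s; rewrite inE => s0; apply/existsP.
  apply: vine_chain => // t st; rewrite inE -card_gt0.
  by apply: leq_trans (subset_leq_card st); rewrite card_gt0.
apply: leq_trans (leq_bigmax_cond _ vE).
rewrite -[X in (X <= _)%N](card_ord n) -(card_imset predT (@set1_inj 'I_n)).
apply: subset_leq_card; apply/subsetP=> _ /imsetP[v _ ->].
rewrite inE /terminal inE; apply/andP; split.
  by apply/set0Pn; exists v; rewrite inE.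
apply/forallP=> t; apply/implyP=> /andP[_]; rewrite cards1 eqSS cards_eq0.
by move=> /eqP ->; rewrite inE eqxx.
Qed.

Theorem theorem8p11 (R : realType) (k : nat) (alpha : int -> R) (eps : nat -> R)
    (h : int -> R)
    (alpha_ge0 : forall i : int, -1 <= i <= k%:Z - 1 -> 0 <= alpha i)
    (eps_ge0 : forall i : nat, (i <= k)%N -> 0 <= eps i)
    (h_gt0_le1 : forall i : int, -1 <= i <= k%:Z - 1 -> 0 < h i <= 1) :
  let eps_term (i : nat) : R := k.+2%:R * eps i / (k.+1 - i)%:R in
  let epsilon : R := \big[Num.min/eps_term 0%N]_(0 <= i < k.+1) eps_term i in
  let lhs : R :=
    (U k.+2)%:R *
    \sum_(0 <= i < k.+1)
      'C(k.+2, i.+2)%:R * i.+1%:R *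
      ((alpha (i%:Z - 1) + h (i%:Z - 1)) / \prod_(i <= j < k) h j%:Z) in
  lhs < epsilon ->
  let gamma : R := h (-1) * \prod_(0 <= j < k) h j%:Z in
  let beta : R := epsilon - lhs in
  forall (d : nat) (V : finType) (X : {set {set V}}) (F : sheaf_data V),
    (k.+1 <= d)%N ->
    is_dcomplex d X ->
    is_sheaf X F ->
    (forall i : nat, (i <= k)%N ->
       local_coboundary_expander d X F i k (eps i)) ->
    (forall i : int, -1 <= i <= k%:Z - 1 ->
       local_skeleton_expander d X i (alpha i)) ->
    (forall x : {set V}, x \in faces X k.+1%:Z -> nontrivial (F x)) ->
    expands_small_locally_minimal d X F k beta gamma.
Proof.
move=> eps_term epsilon lhs lt_lhs gamma beta d V X F kd Xd _ cob skel Fnz.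
move=> f cf f_min f_small.
(* The shift turns dimensions into numbers of vertices: H n is h_{n-1}. *)
pose H n := h (n%:Z - 1); pose a n := alpha (n%:Z - 1).
have rng n : (n <= k)%N -> -1 <= n%:Z - 1 <= k%:Z - 1 by lia.
have H_gt0 n : (n <= k)%N -> 0 < H n by move=> /rng/h_gt0_le1/andP[].
have a_ge0 n : (n <= k)%N -> 0 <= a n by move=> /rng/alpha_ge0.
have HS j : H j.+1 = h j%:Z by rewrite /H intS addrC addKr.
have skel' n z : (n <= k)%N -> z \in nfaces X n ->
    skeleton_expander (d - #|z|) (link X z) (a n).
  by move=> nk; rewrite -faces_subr1; apply: skel; apply: rng.
have gammaE : gamma = \prod_(0 <= j < k.+1) H j.
  rewrite big_nat_recl // /gamma /H sub0r; congr (_ * _).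
  by apply: eq_bigr => j _; rewrite -HS.
set S := supp X f; have SX : S \subset nfaces X k.+1 := supp_card X f.
have S_small : weight_set R d X S < \prod_(0 <= j < k.+1) H j by rewrite -gammaE.
pose fp := fatp d X k S H.
(* The left side of the assumed inequality is nonnegative. *)
have epsilon_ge0 : 0 <= epsilon.
  apply: le_trans (ltW lt_lhs); apply: mulr_ge0 => //; rewrite big_nat.
  apply: sumr_ge0 => i /andP[_ ik]; apply: mulr_ge0; first by rewrite mulr_ge0.
  apply: divr_ge0; first exact: addr_ge0 (a_ge0 i ik) (ltW (H_gt0 i ik)).
  by rewrite big_nat; apply: prodr_ge0 => j /andP[_ jk]; rewrite -HS ltW // H_gt0.
have fatS x : x \in S -> fp x.
  move=> xS; have /subsetP/(_ _ xS) := SX; rewrite inE => /andP[_ /eqP cx].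
  by rewrite /fp /fatp cx fat_top.
have stepS (x y : {set V}) : x \in S -> x \subset y -> #|y| = k.+2 -> fat_step fp y x.
  move=> xS xy cy; rewrite /fat_step xy fatS //= cy.
  by have /subsetP/(_ _ xS) := SX; rewrite inE => /andP[_ /eqP ->]; rewrite eqxx.
have /choice[D D_prop] : forall z : {set V}, exists D : {set {set V}}, fp z ->
  [/\ D \subset nfaces X k.+2, forall y, y \in D -> z \in terminals fp y,
      forall y, y \in D -> terminals fp y = [set z] -> y \in supp X (delta f)
    & epsilon * weight_set R d X [set x in S | z \in terminals fp x]
        <= weight_set R d X D].
  move=> z; have [fz|nfz] := boolP (fp z); last by exists set0.
  have [zk zX] := fatp_card SX fz.
  (* Smallness of f makes the empty face thin, so z has a dimension i >= 0, where coboundary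
     expansion is assumed. *)
  have [i cz] : exists i, #|z| = i.+1.
    case cz: #|z| => [|i]; last by exists i.
    move: fz; rewrite (cards0_eq cz) /fp.
    by rewrite (negbTE (set0_not_fat Xd SX H_gt0 S_small)).
  have ik : (i <= k)%N by rewrite -ltnS -cz.
  have zi : z \in nfaces X i.+1 by rewrite inE zX cz /=.
  have zf : z \in faces X i%:Z by rewrite facesS.
  have Fnz' x : x \in nfaces X k.+2 -> nontrivial (F x) by rewrite -facesS; apply: Fnz.
  have [D [DX D1 D2 D3]] := local_expansion Xd (fun x => z \in terminals fp x)
    kd ik (eps_ge0 i ik) cf f_min zi (cob i ik z zf) Fnz'.
  exists D => _; have cD y : y \in D -> #|y| = k.+2.
    by move/(subsetP DX); rewrite inE => /andP[_ /eqP].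
  split=> //.
  - move=> y yD; have [x [xS zx _ xy _]] := D1 y yD.
    by apply: subsetP zx; apply: terminals_step; apply: stepS => //; apply: cD.
  - move=> y yD ty; apply: D2 => // x xS xy.
    (* Each support face below y has a terminal, which is also one of y and hence equals z. *)
    have [t tx] := terminals_neq0 (fatS x xS).
    have /subsetP/(_ _ tx) := terminals_step (stepS x y xS xy (cD y yD)).
    rewrite ty inE => /eqP tz; rewrite -tz tx andbT.
    exact: terminals_subset tx.
  - apply: le_trans D3; have <- : [set x in S | z \in terminals fp x]
      = [set x in supp X f | (z \subset x) && (z \in terminals fp x)].
      apply/setP=> x; apply/setIdP/setIdP => [[xS zt] | [xS /andP[_ zt]]] //.
      by rewrite zt (terminals_subset zt).
    apply: ler_wpM2r; first exact: weight_set_ge0.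
    by apply: (ge_bigmin_seq _ i predT eps_term); rewrite ?mem_index_iota.
have main := @weight_descent R V d X Xd k S H a kd SX H_gt0 a_ge0 skel' epsilon
  (supp X (delta f)) D epsilon_ge0.
have {}main : epsilon * weight_set R d X S <= weight_set R d X (supp X (delta f)) +
   k.+2%:R * \sum_(0 <= i < k.+1)
     'C(k.+2, i.+2)%:R * i.+1%:R * ((a i + H i) * weight_set R d X (fat d X k S H i.+1)).
  by apply: main => [z|y z|y z|z] /D_prop[] // _ H1 H2 _; [apply: H1 | apply: H2].
rewrite /beta /cnorm -/S mulrBl lerBlDr; apply: le_trans main _; rewrite lerD2l.
apply: (@le_trans _ _ ((U k.+2)%:R * \sum_(0 <= i < k.+1)
     'C(k.+2, i.+2)%:R * i.+1%:R * ((a i + H i) * weight_set R d X (fat d X k S H i.+1)))).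
  apply: ler_wpM2r; last by rewrite ler_nat U_ge.
  rewrite big_nat; apply: sumr_ge0 => i /andP[_ ik]; apply: mulr_ge0; first by rewrite mulr_ge0.
  apply: mulr_ge0; last exact: weight_set_ge0.
  exact: addr_ge0 (a_ge0 i ik) (ltW (H_gt0 i ik)).
rewrite /lhs -mulrA; apply: ler_wpM2l => //; rewrite big_distrl /=.
apply: ler_sum_nat => i /andP[_ ik]; rewrite -[X in _ <= X]mulrA; apply: ler_wpM2l.
  by rewrite mulr_ge0.
rewrite -[X in _ <= X]mulrA; apply: ler_wpM2l.
  exact: addr_ge0 (a_ge0 i ik) (ltW (H_gt0 i ik)).
have p0 : 0 < \prod_(i <= j < k) h j%:Z.
  by rewrite big_nat; apply: prodr_gt0 => j /andP[_ jk]; rewrite -HS H_gt0.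
rewrite [X in _ <= X]mulrC ler_pdivlMr // mulrC.
(* For n = i + 1 the product in [weight_fat] is H (i + 1) ... H k, that is h_i ... h_{k-1}, the
   denominator of the i-th term. *)
have := weight_fat d SX H_gt0 (ik : (i.+1 <= k.+1)%N).
rewrite big_add1 /=; under eq_bigr do rewrite HS.
by [].
Qed.
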